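(* There is an algorithm which, given as input $L_1,\dots,L_{r_1}\in D^{r_0}$ such that the left $D$-module $M = D^{r_0}/D\cdot\{L_1,\dots,L_{r_1}\}$ is holonomic, terminates and outputs a $K$-basis $\{R_1,\dots,R_k\}$ of the space of polynomial solutions $R\in K[x_1,\dots,x_n]^{r_0}$ of the system of linear partial differential equations $L_i\bullet R = 0$, $i=1,\dots,r_1$.
   Context: $K\subset\mathbb{C}$ is a computable subfield: elements of $K$ can be represented with a finite set of data, sums, products and quotients can be calculated in finitely many steps, and there is a finite procedure deciding whether a given expression of elements of $K$ is zero. $D = K\langle x_1,\dots,x_n,\partial_1,\dots,\partial_n\rangle$ is the $n$-th Weyl algebra over $K$, acting on $K[x_1,\dots,x_n]$ as differential operators. $D^{r_0}$ is the free left $D$-module of row vectors, and for $L=[\ell_1,\dots,\ell_{r_0}]\in D^{r_0}$ and a column vector $R=[R^{(1)},\dots,R^{(r_0)}]^T$, $L\bullet R=\sum_j \ell_j\bullet R^{(j)}$, where $\bullet$ is the action of differential operators.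
   Formalization: K is also assumed to have a procedure deciding whether a univariate polynomial over K has a natural-number root; without it the claim fails for some computable K, since solving (x∂ − c)R = 0 decides whether c is a natural number. *)

(* Defs.v *)
From HB Require Import structures.
From mathcomp Require Import all_boot all_order all_algebra.
From mathcomp.multinomials Require Import ssrcomplements.
From mathcomp Require Export mpoly.

Set Implicit Arguments.
Unset Strict Implicit.
Unset Printing Implicit Defensive.

Import GRing.Theory.
Local Open Scope ring_scope.

Section SupportSums.
Variables (n : nat) (A : nzRingType) (V : zmodType).
Variable h : A -> 'X_{1..n} -> V.
Hypothesis hD : forall m a b, h (a + b) m = h a m + h b m.

Lemma support_sum0 m : h 0 m = 0.
Proof. by apply: (addIr (h 0 m)); rewrite -hD !add0r. Qed.

Lemma support_sumw k (p : {mpoly A[n]}) : (msize p <= k)%N ->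
  \sum_(m <- msupp p) h p@_m m = \sum_(m : 'X_{1..n < k}) h p@_m m.
Proof.
move=> lepk; rewrite (big_mksub ('X_{1..n < k})) /=; first last.
- by move=> x /msize_mdeg_lt /leq_trans; apply.
- by rewrite msupp_uniq.
by rewrite big_rmcond //= => i /memN_msupp_eq0 ->; rewrite support_sum0.
Qed.

Lemma support_sumD (p q : {mpoly A[n]}) :
  \sum_(m <- msupp (p + q)) h (p + q)@_m m =
  \sum_(m <- msupp p) h p@_m m + \sum_(m <- msupp q) h q@_m m.
Proof.
pose k := maxn (msize (p + q)) (maxn (msize p) (msize q)).
rewrite !(@support_sumw k) ?leq_max ?leqnn ?orbT //.
by rewrite -big_split; apply: eq_bigr => m _; rewrite mcoeffD hD.
Qed.

Lemma support_sumZX (a : A) m :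
  \sum_(l <- msupp (a *: 'X_[m])) h (a *: 'X_[m])@_l l = h a m.
Proof.
have [->|a0] := eqVneq a 0.
  by rewrite scale0r msupp0 big_nil support_sum0.
by rewrite msuppMCX // big_seq1 mcoeffZ mcoeffX eqxx mulr1.
Qed.

End SupportSums.

Lemma mnm_addind (n : nat) (P : 'X_{1..n} -> Prop) : P 0%MM ->
  (forall b i, P b -> P (b + U_(i))%MM) -> forall b, P b.
Proof.
move=> P0 PU b; have [k] := ubnP (mdeg b); elim: k b => // k IH b.
rewrite ltnS => lebk; have [->//|b0] := eqVneq b 0%MM.
case: (pickP (fun i => b i != 0%N)) => [i|bE]; last first.
  by case/eqP: b0; apply/mnmP => i; rewrite mnm0E; apply/eqP/negbFE/bE.
rewrite -lep1mP => /submK bE; rewrite -bE; apply/PU/IH.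
by move: lebk; rewrite -{1}bE mdegD mdeg1 addn1.
Qed.

Section MultinomIter.
Variables (n : nat) (T : Type) (f : 'I_n -> T -> T).
Hypothesis fC : forall i j q, f i (f j q) = f j (f i q).

Definition mnm_iter (b : 'X_{1..n}) (q : T) : T :=
  foldr (fun i => iter (b i) (f i)) q (enum 'I_n).

Lemma mnm_iter_foldr b q : mnm_iter b q =
  foldr f q (flatten [seq nseq (b i) i | i <- enum 'I_n]).
Proof.
rewrite /mnm_iter; elim: (enum _) => //= i s ->.
by rewrite foldr_cat; elim: (b i) => //= k ->.
Qed.

Lemma foldr_comm_perm (s1 s2 : seq 'I_n) q :
  perm_eq s1 s2 -> foldr f q s1 = foldr f q s2.
Proof.
have h (s : seq 'I_n) x : x \in s -> foldr f q s = f x (foldr f q (rem x s)).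
  elim: s => [|y s ih] //=; rewrite in_cons.
  by case: eqVneq => [->|ne_xy {}/ih ->] //=; rewrite fC.
elim: s1 s2 => [|x s1 ih] s2.
  by rewrite perm_sym => /perm_small_eq ->.
move=> peq; have xs2 : x \in s2 by rewrite -(perm_mem peq) mem_head.
rewrite (h _ _ xs2) /= (ih (rem x s2)) // -(perm_cons x).
by rewrite (permPl peq) perm_to_rem.
Qed.

Lemma mnm_iter0 q : mnm_iter 0%MM q = q.
Proof.
rewrite /mnm_iter; elim: (enum _) => //= i s ->.
by rewrite mnm0E.
Qed.

Lemma mnm_iterDU b i q : mnm_iter (b + U_(i))%MM q = f i (mnm_iter b q).
Proof.
rewrite !mnm_iter_foldr.
rewrite -[RHS]/(foldr _ _ (i :: _)); apply: foldr_comm_perm.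
apply/seq.permP => a /=; rewrite !count_flatten !sumnE !big_map.
rewrite (eq_bigr (fun j => count a (nseq (b j) j) + (i == j) * a j))%N.
  rewrite big_split /= addnC; congr (_ + _)%N.
  rewrite -/(index_enum _) (bigD1 i) //= eqxx mul1n big1 ?addn0 // => j.
  by rewrite eq_sym => /negPf ->.
move=> j _.
by rewrite mnmDE mnm1E nseqD count_cat [in X in (_ + X)%N]count_nseq mulnC.
Qed.

Lemma mnm_iterU i q : mnm_iter U_(i)%MM q = f i q.
Proof. by rewrite -[U_(i)%MM]add0m mnm_iterDU mnm_iter0. Qed.

End MultinomIter.

(* The product of differential operators, in the abstract: [e b] is d^b,
   [T i] is left multiplication by d_i. *)
Section OreProduct.
Variables (n : nat) (A : comNzRingType) (W : lmodType A).
Variables (del : 'I_n -> A -> A) (e : 'X_{1..n} -> W) (T : 'I_n -> W -> W).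
Variable mul : W -> W -> W.
Hypothesis delM : forall i a b, del i (a * b) = del i a * b + a * del i b.
Hypothesis delC : forall i j a, del i (del j a) = del j (del i a).
Hypothesis W_ind : forall P : W -> Prop, P 0 ->
  (forall p q, P p -> P q -> P (p + q)) ->
  (forall a b, P (a *: e b)) -> forall p, P p.
Hypothesis TD : forall i p q, T i (p + q) = T i p + T i q.
Hypothesis TZX : forall i a b,
  T i (a *: e b) = a *: e (b + U_(i))%MM + del i a *: e b.
Hypothesis mulDl : forall p q r, mul (p + q) r = mul p r + mul q r.
Hypothesis mulZX : forall a b q, mul (a *: e b) q = a *: mnm_iter T b q.

Lemma ore_T0 i : T i 0 = 0.
Proof. by apply: (addIr (T i 0)); rewrite -TD !add0r. Qed.

Lemma ore_mul0 q : mul 0 q = 0.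
Proof. by apply: (addIr (mul 0 q)); rewrite -mulDl !add0r. Qed.

Lemma ore_TZ i a q : T i (a *: q) = a *: T i q + del i a *: q.
Proof.
elim/W_ind: q => [|p q Hp Hq|c b].
- by rewrite !(scaler0, ore_T0) addr0.
- by rewrite !(scalerDr, TD) Hp Hq addrACA.
rewrite scalerA !TZX delM scalerDl scalerDr !scalerA.
by rewrite addrA addrAC.
Qed.

Lemma ore_TC i j q : T i (T j q) = T j (T i q).
Proof.
elim/W_ind: q => [|p q Hp Hq|c b].
- by rewrite !ore_T0.
- by rewrite !TD Hp Hq.
rewrite !TZX !TD !TZX (delC i j) addrACA.
by rewrite -addmA [(U_(j) + _)%MM]addmC addmA.
Qed.

Lemma ore_TmD b p q : mnm_iter T b (p + q) = mnm_iter T b p + mnm_iter T b q.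
Proof. by rewrite !mnm_iter_foldr; elim: (flatten _) => //= i s ->. Qed.

Lemma ore_mulDr p q r : mul p (q + r) = mul p q + mul p r.
Proof.
elim/W_ind: p => [|p1 p2 H1 H2|c b].
- by rewrite !ore_mul0 addr0.
- by rewrite !mulDl H1 H2 addrACA.
by rewrite !mulZX ore_TmD scalerDr.
Qed.

Lemma ore_mulZl a p q : mul (a *: p) q = a *: mul p q.
Proof.
elim/W_ind: p => [|p1 p2 H1 H2|c b].
- by rewrite !(scaler0, ore_mul0).
- by rewrite !(scalerDr, mulDl) H1 H2.
by rewrite scalerA !mulZX scalerA.
Qed.

Lemma ore_mulT i p q : mul (T i p) q = T i (mul p q).
Proof.
elim/W_ind: p => [|p1 p2 H1 H2|c b].
- by rewrite !(ore_T0, ore_mul0).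
- by rewrite !(TD, mulDl) H1 H2.
by rewrite TZX mulDl !mulZX ore_TZ (mnm_iterDU ore_TC).
Qed.

Lemma ore_mulA : associative mul.
Proof.
move=> p q r; elim/W_ind: p => [|p1 p2 H1 H2|c b].
- by rewrite !ore_mul0.
- by rewrite !mulDl H1 H2.
rewrite !mulZX ore_mulZl; congr (_ *: _).
rewrite !mnm_iter_foldr; elim: (flatten _) => //= i s ->.
by rewrite ore_mulT.
Qed.

Lemma ore_mul1l : left_id (e 0%MM) mul.
Proof. by move=> q; rewrite -[e _]scale1r mulZX scale1r mnm_iter0. Qed.

Lemma ore_Te i b : T i (e b) = e (b + U_(i))%MM.
Proof.
have del1 : del i 1 = 0.
  by apply: (addrI (del i 1)); rewrite addr0 -{3}[1]mulr1 delM mulr1 mul1r.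
by rewrite -[e b]scale1r TZX scale1r del1 scale0r addr0.
Qed.

Lemma ore_mul1r : right_id (e 0%MM) mul.
Proof.
have Tm1 b : mnm_iter T b (e 0%MM) = e b.
  elim/mnm_addind: b => [|b i IH]; first by rewrite mnm_iter0.
  by rewrite (mnm_iterDU ore_TC) IH ore_Te.
elim/W_ind => [|p q Hp Hq|c b]; first by rewrite ore_mul0.
  by rewrite mulDl Hp Hq.
by rewrite mulZX Tm1.
Qed.

Variable act : W -> A -> A.
Hypothesis actD : forall p q f, act (p + q) f = act p f + act q f.
Hypothesis actZX : forall a b f, act (a *: e b) f = a * mnm_iter del b f.

Lemma ore_act0 f : act 0 f = 0.
Proof. by apply: (addIr (act 0 f)); rewrite -actD !add0r. Qed.

Lemma ore_actZ a p f : act (a *: p) f = a * act p f.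
Proof.
elim/W_ind: p => [|p q Hp Hq|c b].
- by rewrite scaler0 ore_act0 mulr0.
- by rewrite scalerDr !actD Hp Hq mulrDr.
by rewrite scalerA !actZX mulrA.
Qed.

Hypothesis delD : forall i a b, del i (a + b) = del i a + del i b.

Lemma ore_actT i p f : act (T i p) f = del i (act p f).
Proof.
elim/W_ind: p => [|p q Hp Hq|c b].
- rewrite ore_T0 ore_act0.
  by apply: (addIr (del i 0)); rewrite -delD !add0r.
- by rewrite TD !actD Hp Hq delD.
by rewrite TZX actD !actZX delM addrC (mnm_iterDU delC).
Qed.

Lemma ore_actM p q f : act (mul p q) f = act p (act q f).
Proof.
elim/W_ind: p => [|p1 p2 H1 H2|c b].
- by rewrite ore_mul0 !ore_act0.
- by rewrite mulDl !actD H1 H2.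
rewrite mulZX ore_actZ actZX; congr (_ * _).
rewrite !mnm_iter_foldr.
by elim: (flatten _) => //= i s <-; rewrite ore_actT.
Qed.

End OreProduct.

(* An element [\sum_b a_b *: 'X_[b]] of [weyl n K], with coefficients [a_b] in
   K[x_1, ..., x_n], stands for the normally ordered operator
   [\sum_b a_b(x) d^b]: the inner indeterminates are the x_i, the outer ones
   the d_i.  The product is not the commutative product of [mpoly]. *)
Definition weyl (n : nat) (K : fieldType) := {mpoly {mpoly K[n]}[n]}.

Section Weyl.
Variables (n : nat) (K : fieldType).
Local Notation A := {mpoly K[n]}.
Local Notation D := (weyl n K).
Local Notation W := {mpoly {mpoly K[n]}[n]}.

(* d_i . (a d^b) = a d^(b + e_i) + (da/dx_i) d^b *)
Definition weyl_dmul (i : 'I_n) (q : W) : W :=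
  \sum_(b <- msupp q)
     (q@_b *: 'X_[(b + U_(i))%MM] + (q@_b)^`M(i) *: 'X_[b]).

Definition weyl_mul (p q : W) : W :=
  \sum_(b <- msupp p) p@_b *: mnm_iter weyl_dmul b q.

(* x^a d^b *)
Definition weyl_monom (a b : 'X_{1..n}) : D := ('X_[a] : A) *: ('X_[b] : W).

Definition weylC (c : K) : D := (c%:MP_[n])%:MP_[n].

Definition weyl_act (p : D) (f : A) : A :=
  \sum_(b <- msupp p) p@_b * f^`M[b].

Let e (b : 'X_{1..n}) : W := 'X_[b].

Fact weyl_addind (P : W -> Prop) : P 0 ->
  (forall p q, P p -> P q -> P (p + q)) ->
  (forall a b, P (a *: e b)) -> forall p, P p.
Proof.
move=> P0 PD PX; elim/mpolyind => [//|c m p _ _ Pp].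
exact: PD (PX _ _) Pp.
Qed.

Fact ore_termD (B : nzRingType) (V : lmodType B) (d : B -> B) (u v : V) :
  (forall a b, d (a + b) = d a + d b) ->
  forall a b, (a + b) *: u + d (a + b) *: v =
    (a *: u + d a *: v) + (b *: u + d b *: v).
Proof. by move=> dD a b; rewrite dD !scalerDl addrACA. Qed.

Let dmul_term i (a : A) (b : 'X_{1..n}) : W :=
  a *: e (b + U_(i))%MM + a^`M(i) *: e b.

Fact dmul_termD i m a b :
  dmul_term i (a + b) m = dmul_term i a m + dmul_term i b m.
Proof. exact: (ore_termD _ _ (mderivD i)). Qed.

Fact weyl_dmulD i (p q : W) :
  weyl_dmul i (p + q) = weyl_dmul i p + weyl_dmul i q.
Proof. exact: (support_sumD (dmul_termD i)). Qed.

Fact weyl_dmulZX i a b :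
  weyl_dmul i (a *: e b) = a *: e (b + U_(i))%MM + a^`M(i) *: e b.
Proof. exact: (support_sumZX (dmul_termD i)). Qed.

Let mul_term q (a : A) b : W := a *: mnm_iter weyl_dmul b q.

Fact mul_termD q m a b : mul_term q (a + b) m = mul_term q a m + mul_term q b m.
Proof. exact: scalerDl. Qed.

Fact weyl_mulDl : left_distributive weyl_mul +%R.
Proof. by move=> p q r; exact: (support_sumD (mul_termD r)). Qed.

Fact weyl_mulZX a b q : weyl_mul (a *: e b) q = a *: mnm_iter weyl_dmul b q.
Proof. exact: (support_sumZX (mul_termD q)). Qed.

Let act_term f (a : A) b : A := a * f^`M[b].

Fact act_termD f m a b : act_term f (a + b) m = act_term f a m + act_term f b m.
Proof. exact: mulrDl. Qed.

Fact weyl_actD (p q : W) f :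
  weyl_act (p + q) f = weyl_act p f + weyl_act q f.
Proof. exact: (support_sumD (act_termD f)). Qed.

Fact weyl_actZX a b f :
  weyl_act (a *: e b) f = a * mnm_iter (@mderiv n K) b f.
Proof. exact: (support_sumZX (act_termD f)). Qed.

Let delM := @mderivM n K.
Let delC i j (a : A) : a^`M(j)^`M(i) = a^`M(i)^`M(j) := mderiv_comm j i a.

Fact weyl_mulDr : right_distributive weyl_mul +%R.
Proof.
exact: (ore_mulDr weyl_addind weyl_dmulD weyl_mulDl weyl_mulZX).
Qed.

Fact weyl_mulA : associative weyl_mul.
Proof.
exact: (ore_mulA delM delC weyl_addind weyl_dmulD weyl_dmulZX
                 weyl_mulDl weyl_mulZX).
Qed.

Fact weyl_mul1l : left_id (1 : W) weyl_mul.
Proof. rewrite -mpolyX0; exact: (ore_mul1l weyl_mulZX). Qed.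

Fact weyl_mul1r : right_id (1 : W) weyl_mul.
Proof.
rewrite -mpolyX0; exact: (ore_mul1r delM delC weyl_addind weyl_dmulD
                            weyl_dmulZX weyl_mulDl weyl_mulZX).
Qed.

HB.instance Definition _ := GRing.Zmodule.copy D W.
HB.instance Definition _ := GRing.Zmodule_isNzRing.Build D
  weyl_mulA weyl_mul1l weyl_mul1r weyl_mulDl weyl_mulDr (oner_neq0 W).

Lemma weyl_actM (p q : D) f : weyl_act (p * q) f = weyl_act p (weyl_act q f).
Proof.
exact: (ore_actM delM delC weyl_addind weyl_dmulD weyl_dmulZX
          weyl_mulDl weyl_mulZX weyl_actD weyl_actZX (@mderivD n K)).
Qed.

Definition weyl_x (i : 'I_n) : D := weyl_monom U_(i)%MM 0%MM.
Definition weyl_d (i : 'I_n) : D := weyl_monom 0%MM U_(i)%MM.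

Lemma weyl_monomM (a c d : 'X_{1..n}) :
  weyl_monom a 0%MM * weyl_monom c d = weyl_monom (a + c)%MM d.
Proof.
rewrite [LHS]weyl_mulZX mnm_iter0 /weyl_monom.
by rewrite scalerA -mpolyXD.
Qed.

Lemma weyl_d_mul i (p : D) : weyl_d i * p = weyl_dmul i p.
Proof.
rewrite [LHS]weyl_mulZX mpolyX0 scale1r.
by rewrite (mnm_iterU (ore_TC delC weyl_addind weyl_dmulD weyl_dmulZX)).
Qed.

Lemma weyl_xC i j : weyl_x i * weyl_x j = weyl_x j * weyl_x i.
Proof. by rewrite [LHS]weyl_monomM [RHS]weyl_monomM addmC. Qed.

Lemma weyl_dC i j : weyl_d i * weyl_d j = weyl_d j * weyl_d i.
Proof.
have dE k : weyl_d k = e U_(k)%MM by rewrite /weyl_d /weyl_monom mpolyX0 scale1r.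
have Te k l : weyl_dmul k (e U_(l)%MM) = e (U_(l) + U_(k))%MM.
  exact: (ore_Te delM weyl_dmulZX).
by rewrite (weyl_d_mul i) (weyl_d_mul j) (dE i) (dE j) [LHS]Te [RHS]Te addmC.
Qed.

Lemma weyl_dxC i j :
  weyl_d i * weyl_x j - weyl_x j * weyl_d i = (i == j)%:R.
Proof.
rewrite (weyl_d_mul i) [weyl_x j * _]weyl_monomM addm0 /weyl_monom.
rewrite [weyl_dmul _ _]weyl_dmulZX add0m [X in X - _]addrC [LHS]addrK.
rewrite /e mpolyX0 mderivX mnm1E eq_sym.
case: eqVneq => [->|_]; last by rewrite scale0r [LHS]scale0r.
by rewrite -{1}[U_(j)%MM]add0m addmK mpolyX0 scale1r [LHS]scale1r.
Qed.

End Weyl.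

(* [B] maps to a K-basis of the image of [S] in [V / N]; [V] is a vector space
   over K through [phi : K -> A].  With [N := eq 0] this is a basis of [S]. *)
Definition is_basis_mod (K A : nzRingType) (phi : K -> A) (V : lmodType A)
    (S N : V -> Prop) (B : seq V) : Prop :=
  [/\ forall v, v \in B -> S v,
      forall c : 'I_(size B) -> K,
        N (\sum_i phi (c i) *: B`_i) -> forall i, c i = 0
    & forall v, S v ->
        exists c : 'I_(size B) -> K, N (v - \sum_i phi (c i) *: B`_i)].

Section Systems.
Variables (n : nat) (K : fieldType).
Local Notation D := (weyl n K).

Definition row_submodule (r1 r0 : nat) (L : 'M[D]_(r1, r0)) (v : 'rV[D]_r0) :=
  exists Q : 'rV[D]_r1, v = Q *m L.

(* The Bernstein filtration of D^r0. *)
Definition bernstein (r0 k : nat) (v : 'rV[D]_r0) : Prop :=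
  forall (j : 'I_r0) (a b : 'X_{1..n}),
    (v 0 j)@_b@_a != 0 -> (mdeg a + mdeg b <= k)%N.

(* [D^r0 / N] is holonomic: it is zero, or its dimension, i.e., the degree of
   the Hilbert polynomial [chi] of the induced Bernstein filtration, is n. *)
Definition holonomic (r0 : nat) (N : 'rV[D]_r0 -> Prop) : Prop :=
  (forall v, N v) \/
  exists (chi : {poly rat}) (k0 : nat), size chi = n.+1 /\
    forall k, (k0 <= k)%N -> exists B : seq 'rV[D]_r0,
      is_basis_mod (@weylC n K) (bernstein k) N B /\
      chi.[k%:R] = (size B)%:R.

Definition poly_solution (r1 r0 : nat) (L : 'M[D]_(r1, r0))
    (f : 'cV[{mpoly K[n]}]_r0) : Prop :=
  forall i, \sum_j weyl_act (L i j) (f j 0) = 0.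

End Systems.

(* The model of computation: programs of the WHILE language (N. D. Jones,
   Computability and Complexity) on binary trees, in combinator form. *)
Inductive tree := Leaf | Node of tree & tree.

Inductive prog :=
  | PId
  | PLeaf
  | PFst
  | PSnd
  | PNode of prog & prog
  | PComp of prog & prog
  | PIf of prog & prog & prog
  | PWhile of prog & prog.

(* [runs p t u]: on input [t], program [p] halts with output [u].
   [PComp p q] runs [q] first; [Leaf] counts as false in tests. *)
Inductive runs : prog -> tree -> tree -> Prop :=
  | RId t : runs PId t t
  | RLeaf t : runs PLeaf t Leaf
  | RFst t u : runs PFst (Node t u) t
  | RFst0 : runs PFst Leaf Leaf
  | RSnd t u : runs PSnd (Node t u) u
  | RSnd0 : runs PSnd Leaf Leaf
  | RNode p q t u v : runs p t u -> runs q t v -> runs (PNode p q) t (Node u v)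
  | RComp p q t u v : runs q t u -> runs p u v -> runs (PComp p q) t v
  | RIfT c p q t u v w : runs c t (Node u v) -> runs p t w ->
      runs (PIf c p q) t w
  | RIfF c p q t w : runs c t Leaf -> runs q t w -> runs (PIf c p q) t w
  | RWhileT c p t t' u v w : runs c t (Node u v) -> runs p t t' ->
      runs (PWhile c p) t' w -> runs (PWhile c p) t w
  | RWhileF c p t : runs c t Leaf -> runs (PWhile c p) t t.

Lemma runs_det p t u v : runs p t u -> runs p t v -> u = v.
Proof.
move=> H; elim: H v => {p t u}; intros;
  match goal with H : runs _ _ _ |- _ => inversion H; subst end;
  repeat match goal with
    IH : (forall v, runs ?p ?t v -> _ = v), H : runs ?p ?t _ |- _ =>
      have {H} := IH _ H; first [discriminate | move=> ?; subst]
  end; try done; try congruence.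
Qed.

(* [rep t a] reads: the tree [t] represents [a]. *)
Fixpoint rep_nat (t : tree) (k : nat) : Prop :=
  match t, k with
  | Leaf, 0%N => True
  | Node Leaf t', k'.+1 => rep_nat t' k'
  | _, _ => False
  end.

Definition rep_pair (S T : Type) (repS : tree -> S -> Prop)
    (repT : tree -> T -> Prop) (t : tree) (z : S * T) : Prop :=
  if t is Node t1 t2 then repS t1 z.1 /\ repT t2 z.2 else False.

Fixpoint rep_seq (T : Type) (repT : tree -> T -> Prop) (t : tree) (s : seq T)
    : Prop :=
  match t, s with
  | Leaf, [::] => True
  | Node t1 t2, x :: s' => repT t1 x /\ rep_seq repT t2 s'
  | _, _ => False
  end.

Definition rep_mnm (n : nat) (t : tree) (m : 'X_{1..n}) : Prop :=
  rep_seq rep_nat t [seq m i | i <- enum 'I_n].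

Definition rep_mx (T : Type) (repT : tree -> T -> Prop) (r1 r0 : nat)
    (t : tree) (L : 'M[T]_(r1, r0)) : Prop :=
  rep_seq (rep_seq repT) t
    [seq [seq L i j | j <- enum 'I_r0] | i <- enum 'I_r1].

(* [rep t a]: the finite datum [t] represents the element [a] of K.  The zero
   test bears on elements of K ([computable_eq0]) and on polynomial expressions
   with coefficients in K in an unknown natural number ([computable_natroot]).
   The latter does not follow from the other clauses, and it is necessary: a
   basis of the polynomial solutions of b(x_1 d_1) consists of the x_1^k such
   that b(k) = 0. *)
Record computable_field (K : fieldType) (rep : tree -> K -> Prop) : Prop := {
  computable_inj : forall t a b, rep t a -> rep t b -> a = b;
  computable_surj : forall a, exists t, rep t a;
  computable_add : exists p, forall t u a b, rep t a -> rep u b ->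
    exists2 v, runs p (Node t u) v & rep v (a + b);
  computable_mul : exists p, forall t u a b, rep t a -> rep u b ->
    exists2 v, runs p (Node t u) v & rep v (a * b);
  computable_div : exists p, forall t u a b, rep t a -> rep u b -> b != 0 ->
    exists2 v, runs p (Node t u) v & rep v (a / b);
  computable_eq0 : exists p, forall t a, rep t a ->
    exists2 v, runs p t v & v = Leaf <-> a = 0;
  computable_natroot : exists p, forall t (b : seq K), rep_seq rep t b ->
    exists2 v, runs p t v &
      v = Leaf <-> exists k : nat, \sum_(i < size b) b`_i * k%:R ^+ i = 0
}.

Section Representations.
Variables (n : nat) (K : fieldType) (repK : tree -> K -> Prop).

(* Polynomials and operators are given as lists of terms; repeated or zero
   terms are allowed. *)
Definition rep_poly (t : tree) (f : {mpoly K[n]}) : Prop :=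
  exists2 s : seq (K * 'X_{1..n}),
    rep_seq (rep_pair repK (@rep_mnm n)) t s
    & f = \sum_(z <- s) z.1 *: 'X_[z.2].

Definition rep_weyl (t : tree) (p : weyl n K) : Prop :=
  exists2 s : seq (K * ('X_{1..n} * 'X_{1..n})),
    rep_seq (rep_pair repK (rep_pair (@rep_mnm n) (@rep_mnm n))) t s
    & p = \sum_(z <- s) weylC n z.1 * weyl_monom K z.2.1 z.2.2.

(* r0 is part of the input since it cannot be read off when r1 = 0. *)
Definition rep_system (r1 r0 : nat) (t : tree) (L : 'M[weyl n K]_(r1, r0)) :=
  rep_pair rep_nat (fun u => rep_mx rep_weyl u) t (r0, L).

Definition rep_vectors (r0 : nat) (t : tree)
    (B : seq 'cV[{mpoly K[n]}]_r0) : Prop :=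
  rep_seq (fun u => rep_mx rep_poly u) t B.

End Representations.

(* Main.v *)
Require Import Defs.
From HB Require Import structures.
From mathcomp Require Import all_boot all_order all_algebra.
From mathcomp Require Import mpoly reals complex.
From mathcomp Require Import boolp ring.
Import GRing.Theory.
Local Open Scope ring_scope.

Set Implicit Arguments.
Unset Strict Implicit.
Unset Printing Implicit Defensive.

Import Order.TTheory Num.Theory.

(** The degree of a polynomial solution f is bounded componentwise.  Let
    Theta = \sum_i x_i d_i, so that Theta f = deg(f) f for homogeneous f.  If an
    operator P = \sum_ab c_ab x^a Theta^b with c <> 0 satisfies P e_j = Q L, then
    P f_j = 0 for every solution f, and comparing leading monomials shows that
    deg f_j is a root of the polynomial \sum_b c_ab T^b for the largest a for
    which this polynomial is nonzero.  Holonomicity provides such a P by counting: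
    there are (k + 1)^(n + 1) operators x^a Theta^b with b <= k and all entries of
    a at most k, they lie in the Bernstein filtration in degree (n + 2) k, and
    modulo D L this space has a dimension that is polynomial of degree n in k.

    Hence one may search for a number N and, for each j, a level k below N at
    which linear algebra produces a certificate (Q, c) all of whose nonzero
    polynomials \sum_b c_ab T^b have no natural root >= N, a property decided by
    the root test of K after a shift.  The search stops, and the solutions are
    then found by linear algebra among the polynomial vectors with exponents at
    most N. *)

(** * Programs on represented types *)

(** The certificate has to be searched for because the program is given neither the Hilbert
    polynomial nor a bound for the order of Q. Holonomicity enters through the termination of the
    search; that an accepted certificate bounds the degrees is a separate argument.

    Working with Theta instead of the separate x_i d_i makes each column polynomial univariate, as
    the root test of K requires, and the single extra exponent b already lifts the count from order
    k^n to k^(n + 1). In the degree (n + 2) k, the part n k comes from x^a and 2 k from Theta^b,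
    each Theta contributing one x_i and one d_i.

    The root test only says whether some natural root exists. Applied to p(T + N), it tells whether
    all natural roots of p lie below N, so roots never have to be computed. Such an N exists for p
    nonzero because K embeds in the complex numbers and thus has characteristic 0.

    The algorithm is written as ordinary functions on lists. That programs realise them follows from
    closure properties of [tracked], which mirror the syntax of these functions; only a few basic
    programs and loops are written out. *)

Class Rep (T : Type) := rep : tree -> T -> Prop.

(** Every [Node] counts as true, as in the tests of [PIf] and [PWhile]. The answers of the zero test
    and of the root test of K are thus booleans without conversion. *)
Definition rep_bool (t : tree) (b : bool) : Prop :=
  if t is Leaf then b = false else b = true.

#[export] Instance Rep_nat : Rep nat := rep_nat.
#[export] Instance Rep_bool : Rep bool := rep_bool.
#[export] Instance Rep_prod (S T : Type) {RS : Rep S} {RT : Rep T} :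
  Rep (S * T)%type := rep_pair rep rep.
#[export] Instance Rep_seq (T : Type) {RT : Rep T} : Rep (seq T) := rep_seq rep.
#[export] Instance Rep_mnm n : Rep 'X_{1..n} := @rep_mnm n.

(** Realizability by a total program. An element may have several representing trees, and the output
    tree may depend on the one supplied. *)
Definition tracked (A B : Type) {RA : Rep A} {RB : Rep B} (f : A -> B) : Prop :=
  exists p, forall t a, rep t a -> exists2 v, runs p t v & rep v (f a).

Section Closure.
Context {G : Type} {RG : Rep G}.

Lemma tracked_ext (A : Type) {RA : Rep A} (f g : G -> A) :
  f =1 g -> tracked f -> tracked g.
Proof. by move=> e [p hp]; exists p => t a /hp; rewrite e. Qed.

Lemma tr_id : tracked (fun x : G => x).
Proof. by exists PId => t a h; exists t => //; constructor. Qed.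

Lemma tr_comp (A B : Type) {RA : Rep A} {RB : Rep B} (g : A -> B) (f : G -> A) :
  tracked g -> tracked f -> tracked (fun x => g (f x)).
Proof.
move=> [q hq] [p hp]; exists (PComp q p) => t a /hp[u pu /hq[v qv rv]].
by exists v => //; econstructor; eauto.
Qed.

Lemma tr_pair (A B : Type) {RA : Rep A} {RB : Rep B} (f : G -> A) (g : G -> B) :
  tracked f -> tracked g -> tracked (fun x => (f x, g x)).
Proof.
move=> [q hq] [p hp]; exists (PNode q p) => t a ta.
have [[u qu ru] [v pv rv]] := (hq _ _ ta, hp _ _ ta).
by exists (Node u v); first constructor.
Qed.

Lemma tr_fst (A B : Type) {RA : Rep A} {RB : Rep B} (f : G -> A * B) :
  tracked f -> tracked (fun x => (f x).1).
Proof.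
apply: tr_comp; exists PFst => -[|t u] [a b] //= [ta _].
by exists t => //; constructor.
Qed.

Lemma tr_snd (A B : Type) {RA : Rep A} {RB : Rep B} (f : G -> A * B) :
  tracked f -> tracked (fun x => (f x).2).
Proof.
apply: tr_comp; exists PSnd => -[|t u] [a b] //= [_ ta].
by exists u => //; constructor.
Qed.

Lemma tr_comp2 (A B C : Type) {RA : Rep A} {RB : Rep B} {RC : Rep C}
    (h : A -> B -> C) (f : G -> A) (g : G -> B) :
  tracked (fun z : A * B => h z.1 z.2) -> tracked f -> tracked g ->
  tracked (fun x => h (f x) (g x)).
Proof.
by move=> hT fT gT; apply: (tr_comp (g := fun z => h z.1 z.2) hT (tr_pair fT gT)).
Qed.

Lemma tr_comp3 (A B C D : Type) {RA : Rep A} {RB : Rep B} {RC : Rep C}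
    {RD : Rep D} (h : A -> B -> C -> D) (f : G -> A) (g : G -> B) (k : G -> C) :
  tracked (fun z : A * B * C => h z.1.1 z.1.2 z.2) ->
  tracked f -> tracked g -> tracked k -> tracked (fun x => h (f x) (g x) (k x)).
Proof.
move=> hT fT gT kT.
by apply: (tr_comp (g := fun z => h z.1.1 z.1.2 z.2) hT (tr_pair (tr_pair fT gT) kT)).
Qed.

Lemma tr_comp4 (A B C D E : Type) {RA : Rep A} {RB : Rep B} {RC : Rep C}
    {RD : Rep D} {RE : Rep E} (h : A -> B -> C -> D -> E)
    (f : G -> A) (g : G -> B) (k : G -> C) (l : G -> D) :
  tracked (fun z : A * B * C * D => h z.1.1.1 z.1.1.2 z.1.2 z.2) ->
  tracked f -> tracked g -> tracked k -> tracked l ->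
  tracked (fun x => h (f x) (g x) (k x) (l x)).
Proof.
move=> hT fT gT kT lT.
by apply: (tr_comp (g := fun z => h z.1.1.1 z.1.1.2 z.1.2 z.2) hT
  (tr_pair (tr_pair (tr_pair fT gT) kT) lT)).
Qed.

Fixpoint const_prog (t : tree) : prog :=
  if t is Node u v then PNode (const_prog u) (const_prog v) else PLeaf.

Lemma runs_const t u : runs (const_prog u) t u.
Proof. by elim: u => [|u hu v hv] /=; constructor. Qed.

Lemma tr_const (A : Type) {RA : Rep A} (a : A) :
  (exists t, rep t a) -> tracked (fun _ : G => a).
Proof. by case=> u ua; exists (const_prog u) => t b _; exists u => //; exact: runs_const. Qed.

Lemma tr_nil (A : Type) {RA : Rep A} : tracked (fun _ : G => [::] : seq A).
Proof. by apply: tr_const; exists Leaf. Qed.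

Lemma tr_cons (A : Type) {RA : Rep A} (f : G -> A) (g : G -> seq A) :
  tracked f -> tracked g -> tracked (fun x => f x :: g x).
Proof.
move=> [q hq] [p hp]; exists (PNode q p) => t a ta.
have [[u qu ru] [v pv rv]] := (hq _ _ ta, hp _ _ ta).
by exists (Node u v); first constructor.
Qed.

Lemma tr_nat (k : nat) : tracked (fun _ : G => k).
Proof.
apply: tr_const; elim: k => [|k [t tk]]; first by exists Leaf.
by exists (Node Leaf t).
Qed.

Lemma tr_bool (b : bool) : tracked (fun _ : G => b).
Proof. by apply: tr_const; case: b; [exists (Node Leaf Leaf)|exists Leaf]. Qed.

Lemma tr_S (f : G -> nat) : tracked f -> tracked (fun x => (f x).+1).
Proof.
apply: tr_comp; exists (PNode PLeaf PId) => t k tk.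
by exists (Node Leaf t) => //; repeat constructor.
Qed.

Lemma tr_pred (f : G -> nat) : tracked f -> tracked (fun x => (f x).-1).
Proof.
apply: tr_comp; exists PSnd => -[|[|//] t] [|k] //= tk.
  by exists Leaf => //; constructor.
by exists t => //; constructor.
Qed.

Lemma tr_neq0 (f : G -> nat) : tracked f -> tracked (fun x => f x != 0%N).
Proof.
apply: (tr_comp (g := fun k => k != 0%N)); exists PId => t [|k] tk; exists t; try exact: RId.
  by case: t tk => // -[].
by case: t tk.
Qed.

Lemma tr_behead (A : Type) {RA : Rep A} (f : G -> seq A) :
  tracked f -> tracked (fun x => behead (f x)).
Proof.
apply: tr_comp; exists PSnd => -[|t u] [|a s] //= tk.
  by exists Leaf => //; constructor.
by case: tk => _ us; exists u => //; constructor.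
Qed.

Lemma tr_if (A : Type) {RA : Rep A} (b : G -> bool) (f g : G -> A) :
  tracked b -> tracked f -> tracked g -> tracked (fun x => if b x then f x else g x).
Proof.
move=> [r hr] [p hp] [q hq]; exists (PIf r p q) => t a ta.
have [[|c1 c2] rc] := hr _ _ ta; rewrite /rep /= => ->.
  by have [v qv rv] := hq _ _ ta; exists v => //; apply: RIfF.
by have [v qv rv] := hp _ _ ta; exists v => //; apply: RIfT; eauto.
Qed.

Lemma tr_head (A : Type) {RA : Rep A} (f : G -> A) (s : G -> seq A) :
  tracked f -> tracked s -> tracked (fun x => head (f x) (s x)).
Proof.
move=> [p hp] [q hq]; exists (PIf q (PComp PFst q) p) => t a ta.
have [c qc] := hq _ _ ta; case: c qc => [|c d] qc; case: (s a) => //=.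
  by move=> _; have [v pv rv] := hp _ _ ta; exists v => //; apply: RIfF.
move=> x l [rx _]; exists c => //; apply: RIfT; first exact: qc.
by econstructor; [exact: qc | constructor].
Qed.

End Closure.

(* Hook for the lemmas of later sections, redefined as they become available. *)
Ltac trk_more := fail.
Ltac trk :=
  cbn beta;
  lazymatch goal with
  | |- tracked (fun x => _) => idtac
  | |- @tracked ?A ?B ?RA ?RB ?f => change (@tracked A B RA RB (fun x => f x))
  end;
  lazymatch goal with
  | |- tracked fst => exact (tr_fst tr_id)
  | |- tracked snd => exact (tr_snd tr_id)
  | |- tracked (fun x => x) => exact tr_id
  | |- tracked (fun x => pair _ _) => eapply tr_pair; trk
  | |- tracked (fun x => fst _) => eapply tr_fst; trk
  | |- tracked (fun x => snd _) => eapply tr_snd; trk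
  | |- tracked (fun x => nil) => exact tr_nil
  | |- tracked (fun x => cons _ _) => eapply tr_cons; trk
  | |- tracked (fun x => O) => exact (tr_nat _)
  | |- tracked (fun x => S _) => eapply tr_S; trk
  | |- tracked (fun x => predn _) => eapply tr_pred; trk
  | |- tracked (fun x => behead _) => eapply tr_behead; trk
  | |- tracked (fun x => head _ _) => eapply tr_head; trk
  | |- tracked (fun x => if _ then _ else _) => eapply tr_if; trk
  | |- tracked (fun x => true) => exact (tr_bool _)
  | |- tracked (fun x => false) => exact (tr_bool _)
  | |- tracked _ => first [eassumption | trk_more; trk]
  end.

(** * Loops over represented lists and numbers *)

Section Loops.
Context {G : Type} {RG : Rep G}.
Lemma tr_foldl (A B : Type) {RA : Rep A} {RB : Rep B} (h : G -> B -> A -> B)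
    (z : G -> B) (s : G -> seq A) :
  tracked (fun x : G * (B * A) => h x.1 x.2.1 x.2.2) -> tracked z -> tracked s ->
  tracked (fun x => foldl (h x) (z x) (s x)).
Proof.
move=> [p hp] zT sT.
(* The loop state is (environment, (accumulator, remaining list)). The environment is carried along
   because the language has no closures, and the guard reads the remaining list, which is [Leaf]
   exactly when it is empty. *)
pose body := PNode PFst (PNode
  (PComp p (PNode PFst (PNode (PComp PFst PSnd) (PComp PFst (PComp PSnd PSnd)))))
  (PComp PSnd (PComp PSnd PSnd))).
apply: (tr_comp (g := fun y : G * (B * seq A) => foldl (h y.1) y.2.1 y.2.2)
  (f := fun x => (x, (z x, s x)))); last first.
  by apply: tr_pair (tr_pair zT sT); exact: tr_id.
exists (PComp (PComp PFst PSnd) (PWhile (PComp PSnd PSnd) body)).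
move=> [|t [|tb ts]] [x [b l]] //=; rewrite /rep /= ?andbF; first by case.
move=> [tx [rb rl]].
elim: l b tb ts rb rl => [|a l IH] b tb ts /= rb rl.
  case: ts rl => // _; exists tb => //; econstructor.
    by apply: RWhileF; repeat econstructor.
  by repeat econstructor.
case: ts rl => // ta ts [ra rl].
have [tb' run rb'] := hp (Node t (Node tb ta)) (x, (b, a)) (conj tx (conj rb ra)).
have [v rv hv] := IH _ _ _ rb' rl; exists v => //.
(* The run on the tail is taken apart so that one more loop iteration can be put in front of it. *)
inversion rv as [| | | | | | |? ? ? ? ? H1 H2| | | |]; subst.
econstructor; last exact: H2.
apply: RWhileT H1; first by repeat econstructor.
repeat econstructor; exact: run.
Qed.

(** With the unit value represented by [Leaf], the tree of a number k is also the tree of a list of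
    k units, so that a fold does the iteration. *)
Lemma tr_iter (A : Type) {RA : Rep A} (h : G -> A -> A) (k : G -> nat) (z : G -> A) :
  tracked (fun x : G * A => h x.1 x.2) -> tracked k -> tracked z ->
  tracked (fun x => iter (k x) (h x) (z x)).
Proof.
move=> hT kT zT; pose RU : Rep unit := fun t _ => t = Leaf.
apply: (tracked_ext (f := fun x => foldl (fun b _ => h x b) (z x) (nseq (k x) tt))).
  move=> x; elim: (k x) (z x) => //= m IH y.
  by rewrite IH -iterSr.
apply: (tr_foldl (h := fun x b (_ : unit) => h x b)) zT _; last first.
  case: kT => p hp; exists p => t a /hp[v pv rv]; exists v => //.
  by elim: (k a) v rv {pv} => [|m IH] [|[] v] //= /IH.
by apply: (tr_comp2 hT); trk.
Qed.

Lemma tr_rev (A : Type) {RA : Rep A} (s : G -> seq A) :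
  tracked s -> tracked (fun x => rev (s x)).
Proof.
move=> sT; apply: (tracked_ext (f := fun x => foldl (fun b a => a :: b) [::] (s x))).
  move=> x; rewrite -[s x in LHS]revK foldl_rev.
  by elim: (rev (s x)) => //= a l ->.
by apply: (tr_foldl (h := fun _ b a => a :: b)) sT; trk.
Qed.

Lemma tr_foldr (A B : Type) {RA : Rep A} {RB : Rep B} (h : G -> A -> B -> B)
    (z : G -> B) (s : G -> seq A) :
  tracked (fun x : G * A * B => h x.1.1 x.1.2 x.2) -> tracked z -> tracked s ->
  tracked (fun x => foldr (h x) (z x) (s x)).
Proof.
move=> hT zT sT.
apply: (tracked_ext (f := fun x => foldl (fun b a => h x a b) (z x) (rev (s x)))).
  by move=> x; rewrite foldl_rev.
apply: (tr_foldl (h := fun x b a => h x a b)) zT (tr_rev sT).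
by apply: (tr_comp3 hT); trk.
Qed.

Lemma tr_map (A B : Type) {RA : Rep A} {RB : Rep B} (h : G -> A -> B)
    (s : G -> seq A) :
  tracked (fun x : G * A => h x.1 x.2) -> tracked s ->
  tracked (fun x => [seq h x a | a <- s x]).
Proof.
move=> hT sT.
apply: (tr_foldr (h := fun x a b => h x a :: b)) _ sT; last by trk.
by apply: tr_cons; [apply: (tr_comp2 hT)|]; trk.
Qed.

End Loops.

Lemma tr_cat (G : Type) {RG : Rep G} (A : Type) {RA : Rep A} (s t : G -> seq A) :
  tracked s -> tracked t -> tracked (fun x => s x ++ t x).
Proof.
move=> sT tT; apply: (tracked_ext (f := fun x => foldr cons (t x) (s x))).
  by move=> x; elim: (s x) => //= a l ->.
by apply: (tr_foldr (h := fun _ => cons)); trk.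
Qed.

Lemma tr_flatten (G : Type) {RG : Rep G} (A : Type) {RA : Rep A} (s : G -> seq (seq A)) :
  tracked s -> tracked (fun x => flatten (s x)).
Proof.
move=> sT; apply: (tr_foldr (h := fun _ a b => a ++ b)) sT; last by trk.
by apply: tr_cat; trk.
Qed.

Lemma tr_filter (G : Type) {RG : Rep G} (A : Type) {RA : Rep A}
    (h : G -> A -> bool) (s : G -> seq A) :
  tracked (fun x : G * A => h x.1 x.2) -> tracked s ->
  tracked (fun x => [seq a <- s x | h x a]).
Proof.
move=> hT sT.
apply: (tr_foldr (h := fun x a b => if h x a then a :: b else b)) sT; last by trk.
by apply: tr_if; [apply: (tr_comp2 hT)| |]; trk.
Qed.

Lemma tr_and (G : Type) {RG : Rep G} (a b : G -> bool) :
  tracked a -> tracked b -> tracked (fun x => a x && b x).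
Proof.
by move=> aT bT; apply: (tracked_ext (f := fun x => if a x then b x else false)) => //; trk.
Qed.

Lemma tr_or (G : Type) {RG : Rep G} (a b : G -> bool) :
  tracked a -> tracked b -> tracked (fun x => a x || b x).
Proof.
by move=> aT bT; apply: (tracked_ext (f := fun x => if a x then true else b x)) => //; trk.
Qed.

Lemma tr_neg (G : Type) {RG : Rep G} (a : G -> bool) : tracked a -> tracked (fun x => ~~ a x).
Proof.
by move=> aT; apply: (tracked_ext (f := fun x => if a x then false else true)) => //; trk.
Qed.

Lemma tr_all (G : Type) {RG : Rep G} (A : Type) {RA : Rep A}
    (h : G -> A -> bool) (s : G -> seq A) :
  tracked (fun x : G * A => h x.1 x.2) -> tracked s ->
  tracked (fun x => all (h x) (s x)).
Proof.
move=> hT sT.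
apply: (tr_foldr (h := fun x a b => h x a && b)) sT; last by trk.
by apply: tr_and; [apply: (tr_comp2 hT)|]; trk.
Qed.

Lemma tr_has (G : Type) {RG : Rep G} (A : Type) {RA : Rep A}
    (h : G -> A -> bool) (s : G -> seq A) :
  tracked (fun x : G * A => h x.1 x.2) -> tracked s ->
  tracked (fun x => has (h x) (s x)).
Proof.
move=> hT sT.
apply: (tr_foldr (h := fun x a b => h x a || b)) sT; last by trk.
by apply: tr_or; [apply: (tr_comp2 hT)|]; trk.
Qed.

Lemma tr_addn (G : Type) {RG : Rep G} (k l : G -> nat) :
  tracked k -> tracked l -> tracked (fun x => k x + l x)%N.
Proof.
move=> kT lT; apply: (tracked_ext (f := fun x => iter (k x) S (l x))).
  by move=> x; elim: (k x) => //= m ->.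
by apply: (tr_iter (h := fun _ => S)); trk.
Qed.

Lemma tr_subn (G : Type) {RG : Rep G} (k l : G -> nat) :
  tracked k -> tracked l -> tracked (fun x => k x - l x)%N.
Proof.
move=> kT lT; apply: (tracked_ext (f := fun x => iter (l x) predn (k x))).
  by move=> x; elim: (l x) (k x) => [|m IH] k' /=; rewrite ?subn0 // IH subnS.
by apply: (tr_iter (h := fun _ => predn)); trk.
Qed.

Lemma tr_nseq (G : Type) {RG : Rep G} (A : Type) {RA : Rep A} (k : G -> nat) (a : G -> A) :
  tracked k -> tracked a -> tracked (fun x => nseq (k x) (a x)).
Proof.
move=> kT aT; apply: (tracked_ext (f := fun x => iter (k x) (cons (a x)) [::])).
  by move=> x; elim: (k x) => //= m ->.
apply: (tr_iter (h := fun x => cons (a x))); [|trk|trk].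
by apply: tr_cons; [apply: (tr_comp aT)|]; trk.
Qed.

Lemma tr_iota (G : Type) {RG : Rep G} (k l : G -> nat) :
  tracked k -> tracked l -> tracked (fun x => iota (k x) (l x)).
Proof.
move=> kT lT.
apply: (tracked_ext (f := fun x =>
  rev (iter (l x) (fun z => (z.1.+1, z.1 :: z.2)) (k x, [::])).2)).
  move=> x; rewrite -[iota _ _]revK; congr (rev _).
  suff -> : forall m, iter m (fun z => (z.1.+1, z.1 :: z.2)) (k x, [::]) =
    ((k x + m)%N, rev (iota (k x) m)) by [].
  by elim=> [|m IH]; rewrite ?addn0 // iterS IH
    -[m.+1]addn1 iotaD rev_cat addn1 addnS.
apply: tr_rev; apply: tr_snd.
by apply: (tr_iter (h := fun _ z => (z.1.+1, z.1 :: z.2))); trk.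
Qed.

Lemma tr_nth (G : Type) {RG : Rep G} (A : Type) {RA : Rep A}
    (a : G -> A) (s : G -> seq A) (k : G -> nat) :
  tracked a -> tracked s -> tracked k -> tracked (fun x => nth (a x) (s x) (k x)).
Proof.
move=> aT sT kT; apply: (tracked_ext (f := fun x =>
  head (a x) (iter (k x) behead (s x)))).
  move=> x; elim: (k x) (s x) => [|m IH] [|b l] //; rewrite iterSr IH //=.
  by rewrite nth_nil.
by apply: tr_head => //; apply: (tr_iter (h := fun _ => behead)); trk.
Qed.

Lemma tr_eqn (G : Type) {RG : Rep G} (k l : G -> nat) :
  tracked k -> tracked l -> tracked (fun x => k x == l x).
Proof.
move=> kT lT; apply: (tracked_ext (f := fun x =>
  ~~ (k x - l x != 0)%N && ~~ (l x - k x != 0)%N)).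
  by move=> x; rewrite !negbK !subn_eq0 -eqn_leq.
by apply: tr_and; apply: tr_neg; apply: tr_neq0; apply: tr_subn.
Qed.

Lemma tr_eqb (G : Type) {RG : Rep G} (a b : G -> bool) :
  tracked a -> tracked b -> tracked (fun x => a x == b x).
Proof.
move=> aT bT; apply: (tracked_ext (f := fun x => if a x then b x else ~~ b x)).
  by move=> x; case: (a x) (b x) => -[].
by apply: tr_if => //; exact: tr_neg.
Qed.

Lemma tr_eqpair (G : Type) {RG : Rep G} (A B : eqType) {RA : Rep A} {RB : Rep B}
    (f g : G -> A * B) :
  tracked (fun z : A * A => z.1 == z.2) -> tracked (fun z : B * B => z.1 == z.2) ->
  tracked f -> tracked g -> tracked (fun x => f x == g x).
Proof.
move=> aT bT fT gT; apply: (tracked_ext (f := fun x =>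
  ((f x).1 == (g x).1) && ((f x).2 == (g x).2))).
  by move=> x; case: (f x) (g x) => [a b] [c d]; rewrite xpair_eqE.
by apply: tr_and; [apply: (tr_comp2 aT)|apply: (tr_comp2 bT)]; trk.
Qed.

(* Loops over an index list that is fixed in advance, unlike the lists computed
   at run time of the previous lemmas. *)
Lemma tr_foldr_const (G : Type) {RG : Rep G} (I A : Type) {RA : Rep A}
    (h : I -> G -> A -> A) (z : G -> A) (s : seq I) :
  (forall i, tracked (fun x : G * A => h i x.1 x.2)) -> tracked z ->
  tracked (fun x => foldr (fun i => h i x) (z x) s).
Proof.
move=> hT zT; elim: s => [//|i s IH] /=.
by apply: (tr_comp2 (hT i)); trk.
Qed.

Lemma tr_map_const (G : Type) {RG : Rep G} (I A : Type) {RA : Rep A}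
    (h : I -> G -> A) (s : seq I) :
  (forall i, tracked (h i)) -> tracked (fun x => [seq h i x | i <- s]).
Proof.
move=> hT; apply: (tr_foldr_const (h := fun i x b => h i x :: b)); last exact: tr_nil.
by move=> i; apply: tr_cons; [apply: (tr_comp (hT i))|]; trk.
Qed.

Section Multinomials.
Variable n : nat.

(** The number n of variables is fixed before the program, so one program per coordinate can be
    assembled into a program for the list of exponents. *)
Lemma tr_mnm (G : Type) {RG : Rep G} (f : G -> 'X_{1..n}) :
  (forall i, tracked (fun x => f x i)) -> tracked f.
Proof.
move=> fT.
by have [p hp] := tr_map_const (h := fun i x => f x i) (enum 'I_n) fT; exists p.
Qed.

Lemma tr_mnmE (G : Type) {RG : Rep G} (f : G -> 'X_{1..n}) i :
  tracked f -> tracked (fun x => f x i).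
Proof.
move=> [p hp]; apply: (tracked_ext (f := fun x =>
  nth 0%N [seq f x i | i <- enum 'I_n] i)).
  by move=> x; rewrite (nth_map i) ?nth_ord_enum // size_enum_ord.
by apply: tr_nth; [exact: tr_nat| exists p|exact: tr_nat].
Qed.

Lemma tr_mnm_const (G : Type) {RG : Rep G} (m : 'X_{1..n}) : tracked (fun _ : G => m).
Proof. by apply: tr_mnm => i; exact: tr_nat. Qed.

Lemma tr_mnmD (G : Type) {RG : Rep G} (f g : G -> 'X_{1..n}) :
  tracked f -> tracked g -> tracked (fun x => (f x + g x)%MM).
Proof.
move=> fT gT; apply: tr_mnm => i; apply: (tracked_ext (f := fun x => f x i + g x i)%N).
  by move=> x; rewrite mnmDE.
by apply: tr_addn; exact: tr_mnmE.
Qed.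

Lemma tr_mnmB (G : Type) {RG : Rep G} (f g : G -> 'X_{1..n}) :
  tracked f -> tracked g -> tracked (fun x => (f x - g x)%MM).
Proof.
move=> fT gT; apply: tr_mnm => i; apply: (tracked_ext (f := fun x => f x i - g x i)%N).
  by move=> x; rewrite mnmBE.
by apply: tr_subn; exact: tr_mnmE.
Qed.

Lemma tr_mnmMn (G : Type) {RG : Rep G} (f : G -> 'X_{1..n}) (k : G -> nat) :
  tracked f -> tracked k -> tracked (fun x => (f x *+ k x)%MM).
Proof.
move=> fT kT; apply: tr_mnm => i.
apply: (tracked_ext (f := fun x => iter (k x) (addn (f x i)) 0%N)).
  by move=> x; rewrite mulmnE iter_addn_0.
apply: (tr_iter (h := fun x => addn (f x i))) => //; last exact: tr_nat.
by apply: tr_addn; [apply: (tr_comp (tr_mnmE i fT))|]; trk.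
Qed.

Lemma tr_eqmnm (G : Type) {RG : Rep G} (f g : G -> 'X_{1..n}) :
  tracked f -> tracked g -> tracked (fun x => f x == g x).
Proof.
move=> fT gT.
apply: (tracked_ext (f := fun x => all (fun i => f x i == g x i) (enum 'I_n))).
  move=> x; apply/allP/eqP => [h|-> //]; apply/mnmP => i.
  by apply/eqP/h; rewrite mem_enum.
apply: (tr_foldr_const (h := fun i x b => (f x i == g x i) && b)); last exact: tr_bool.
move=> i; apply: tr_and; last by trk.
by apply: tr_eqn; apply: tr_mnmE; [apply: (tr_comp fT)|apply: (tr_comp gT)]; trk.
Qed.

End Multinomials.

Ltac trk_library :=
  lazymatch goal with
  | |- tracked (fun x => cat _ _) => eapply tr_cat
  | |- tracked (fun x => flatten _) => eapply tr_flatten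
  | |- tracked (fun x => filter _ _) => eapply tr_filter
  | |- tracked (fun x => map _ _) => eapply tr_map
  | |- tracked (fun x => foldr _ _ _) => eapply tr_foldr
  | |- tracked (fun x => foldl _ _ _) => eapply tr_foldl
  | |- tracked (fun x => all _ _) => eapply tr_all
  | |- tracked (fun x => has _ _) => eapply tr_has
  | |- tracked (fun x => iter _ _ _) => eapply tr_iter
  | |- tracked (fun x => iota _ _) => eapply tr_iota
  | |- tracked (fun x => nth _ _ _) => eapply tr_nth
  | |- tracked (fun x => nseq _ _) => eapply tr_nseq
  | |- tracked (fun x => addn _ _) => eapply tr_addn
  | |- tracked (fun x => subn _ _) => eapply tr_subn
  | |- tracked (fun x => andb _ _) => eapply tr_and
  | |- tracked (fun x => orb _ _) => eapply tr_or
  | |- tracked (fun x => negb _) => eapply tr_neg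
  | |- tracked (fun x => mnm_add _ _) => eapply tr_mnmD
  | |- tracked (fun x => mnm_sub _ _) => eapply tr_mnmB
  | |- tracked (fun x => mnm_muln _ _) => eapply tr_mnmMn
  | |- tracked (fun x => fun_of_multinom _ _) => eapply tr_mnmE
  | |- tracked (fun x => mnm1 _) => exact (tr_mnm_const _)
  | |- tracked (fun x => mnm0) => exact (tr_mnm_const _)
  | |- tracked (fun x => eq_op _ _) =>
    first [eapply tr_eqn | eapply tr_eqb | eapply tr_eqmnm | eapply tr_eqpair]
  end.
Ltac trk_more ::= trk_library.

(** Unbounded minimisation, the one place where halting depends on the input. The input is returned
    along with the number found because the next program needs both. *)
Lemma tracked_search (G : Type) {RG : Rep G} (test : G -> nat -> bool) :
  tracked (fun z : G * nat => test z.1 z.2) ->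
  exists p, forall t x, rep t x -> (exists k, test x k) ->
    exists v k, [/\ runs p t v, rep v (x, k) & test x k].
Proof.
move=> /tr_neg[q hq].
pose p := PWhile q (PNode PFst (PNode PLeaf PSnd)).
exists (PComp p (PNode PId PLeaf)) => t x tx [k0 k0P].
(* Here [d] is the distance from the current candidate to a known witness. It bounds the remaining
   iterations, even if the search stops at an earlier candidate. *)
have main d k tk : rep tk k -> test x (k + d)%N ->
    exists v k', [/\ runs p (Node t tk) v, rep v (x, k') & test x k'].
  elim: d k tk => [|d IH] k tk rk ht.
    exists (Node t tk), k; split=> //; last by rewrite addn0 in ht.
    have [c qc] := hq (Node t tk) (x, k) (conj tx rk).
    rewrite addn0 in ht; rewrite /= ht; case: c qc => // qc _; exact: RWhileF.
  case htk: (test x k).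
    have [c qc] := hq (Node t tk) (x, k) (conj tx rk).
    rewrite /= htk; case: c qc => // qc _.
    by exists (Node t tk), k; split=> //; exact: RWhileF.
  have [|v [k' [rv hv tv]]] := IH k.+1 (Node Leaf tk) rk; first by rewrite addSnnS.
  exists v, k'; split=> //.
  have [c qc] := hq (Node t tk) (x, k) (conj tx rk).
  rewrite /= htk; case: c qc => // c1 c2 qc _; apply: RWhileT qc _ rv.
  by repeat constructor.
have [v [k [rv hv tv]]] := main k0 0%N Leaf I k0P.
exists v, k; split=> //; apply: RComp rv.
by repeat constructor.
Qed.

(** * Linear algebra on sparse vectors *)

Section SparseVectors.
Variables (K : fieldType) (I : eqType).
Local Notation vec := (seq (K * I)).
Implicit Types (v p q : vec) (s : seq vec) (x y : I -> K) (i : I) (c : K).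

Definition coef v i : K := foldr (fun z b => if z.2 == i then z.1 + b else b) 0 v.

Definition scalev c v : vec := [seq (c * z.1, z.2) | z <- v].

Lemma coefE v i : coef v i = \sum_(z <- v | z.2 == i) z.1.
Proof. by elim: v => [|z v IH]; rewrite (big_nil, big_cons) //= IH. Qed.

Lemma coef_cat p q i : coef (p ++ q) i = coef p i + coef q i.
Proof. by rewrite !coefE big_cat. Qed.

Lemma coef_scalev c v i : coef (scalev c v) i = c * coef v i.
Proof. by rewrite !coefE big_map mulr_sumr. Qed.

Lemma coef_flatten (T : Type) (l : seq T) (f : T -> vec) i :
  coef (flatten [seq f a | a <- l]) i = \sum_(a <- l) coef (f a) i.
Proof. by elim: l => [|a l IH]; rewrite (big_nil, big_cons) //= coef_cat IH. Qed.

Lemma coef_notin v i : i \notin map snd v -> coef v i = 0.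
Proof.
elim: v => //= z v IH; rewrite inE negb_or => /andP[h /IH ->].
by rewrite eq_sym (negPf h).
Qed.

(** The span consists of coordinate functions, not of lists: the lists are never normalised, and
    different lists may have the same coordinates. The index type may be infinite, which is why no
    matrices are used. *)
Fixpoint lspan s x : Prop :=
  if s is p :: s' then exists c, lspan s' (fun i => x i - c * coef p i)
  else x =1 (fun=> 0).

Fixpoint lfree s : Prop :=
  if s is p :: s' then lfree s' /\ ~ lspan s' (coef p) else True.

Lemma lspan_ext s x y : x =1 y -> lspan s x -> lspan s y.
Proof.
elim: s x y => [|p s IH] x y e /=; first by move=> h i; rewrite -e.
by case=> c h; exists c; apply: IH h => i; rewrite e.
Qed.

Lemma lspan_lin s c x y : lspan s x -> lspan s y -> lspan s (fun i => c * x i + y i).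
Proof.
elim: s x y => [|p s IH] x y /=; first by move=> h1 h2 i; rewrite h1 h2 mulr0 addr0.
move=> [a ha] [b hb]; exists (c * a + b); apply: lspan_ext (IH _ _ ha hb) => i.
by rewrite mulrBr mulrDl opprD mulrA addrACA.
Qed.

Lemma lspan0 s : lspan s (fun=> 0).
Proof.
elim: s => //= p s IH; exists 0; apply: lspan_ext IH => i.
by rewrite mul0r subr0.
Qed.

Lemma lspanZ s c x : lspan s x -> lspan s (fun i => c * x i).
Proof.
move=> h; apply: lspan_ext (lspan_lin c h (lspan0 s)) => i.
by rewrite addr0.
Qed.

Lemma lspanB s x y : lspan s x -> lspan s y -> lspan s (fun i => x i - y i).
Proof.
move=> hx hy; apply: lspan_ext (lspan_lin (-1) hy hx) => i.
by rewrite mulN1r addrC.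
Qed.

Lemma lspan_sum s (T : eqType) (l : seq T) (f : T -> K) (g : T -> I -> K) :
  {in l, forall a, lspan s (g a)} -> lspan s (fun i => \sum_(a <- l) f a * g a i).
Proof.
elim: l => [_|a l IH h].
  by apply: lspan_ext (lspan0 s) => i; rewrite big_nil.
have {}IH := IH (fun b bl => h b (mem_behead (s := a :: l) bl)).
by apply: lspan_ext (lspan_lin (f a) (h a (mem_head _ _)) IH) => i; rewrite big_cons.
Qed.

Lemma lspan_cons p s x : lspan s x -> lspan (p :: s) x.
Proof. by move=> h; exists 0; apply: lspan_ext h => i; rewrite mul0r subr0. Qed.

Lemma lspan_mem s v : v \in s -> lspan s (coef v).
Proof.
elim: s => //= p s IH; rewrite inE => /orP[/eqP ->|/IH].
  by exists 1; apply: lspan_ext (lspan0 s) => i; rewrite mul1r subrr.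
exact: lspan_cons.
Qed.

Lemma lspan_ind (P : (I -> K) -> Prop) s :
  (forall x y, x =1 y -> P x -> P y) -> P (fun=> 0) ->
  (forall v c x, v \in s -> P x -> P (fun i => x i + c * coef v i)) ->
  forall x, lspan s x -> P x.
Proof.
move=> Pext P0; elim: s => [|p s IH] Pc x /=.
  by move=> h; apply: Pext P0 => i.
case=> c /IH h; have /h : forall v c x, v \in s -> P x ->
    P (fun i => x i + c * coef v i).
  by move=> v c' y vs; apply: Pc; rewrite inE vs orbT.
move=> /(Pc p c _ (mem_head _ _)); apply: Pext => i.
by rewrite subrK.
Qed.

(* The first [p] with a nonzero coordinate [i] serves as pivot; the vectors
   before it need no reduction. *)
Fixpoint elim1 i s : seq vec :=
  if s is p :: s' then
    if coef p i == 0 then p :: elim1 i s'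
    else [seq q ++ scalev (- (coef q i / coef p i)) p | q <- s']
  else [::].

(** Reduction by the pivot is the linear map taking y to y - (y_i / a) p, so the reduced list spans
    the image of the span of [s]. *)
Lemma lspan_reduce (p : vec) (a : K) i s x :
  lspan [seq q ++ scalev (- (coef q i / a)) p | q <- s] x <->
  exists2 y, lspan s y & forall j, x j = y j - y i / a * coef p j.
Proof.
elim: s x => [|q s IH] x /=; split.
- by move=> h; exists (fun=> 0) => // j; rewrite h !mul0r subrr.
- by case=> y y0 h j; rewrite h !y0 !mul0r subrr.
- move=> [c /IH[y ys h]]; exists (fun j => y j + c * coef q j).
    by exists c; apply: lspan_ext ys => j; rewrite addrK.
  move=> j; have := h j; rewrite coef_cat coef_scalev => /eqP.
  rewrite subr_eq => /eqP ->; ring.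
move=> [y [c ys] h]; exists c; apply/IH; eexists; first exact: ys.
move=> j; rewrite /= h coef_cat coef_scalev; ring.
Qed.

(** In the pivot case, vanishing at [i] forces the coefficient of [p] to be - y_i / p_i, where y is
    the part of the vector in the span of the remaining list. *)
Lemma lspan_elim1 i s x : lspan (elim1 i s) x <-> lspan s x /\ x i = 0.
Proof.
elim: s x => [|p s IH] x /=; first by split=> [h|[]//]; rewrite !h.
case: eqP => [p0|/eqP p0] /=.
  split=> [[c /IH[h]]|[[c h] x0]].
    by rewrite p0 mulr0 subr0; split=> //; exists c.
  by exists c; apply/IH; split=> //; rewrite x0 p0 mulr0 subr0.
rewrite lspan_reduce; split=> [[y ys h]|[[c h] x0]].
  split; last by rewrite h divfK // subrr.
  exists (- (y i / coef p i)); apply: lspan_ext ys => j.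
  by rewrite h mulNr opprK subrK.
eexists; first exact: h.
by move=> j /=; rewrite x0 sub0r mulNr mulfK // mulNr opprK subrK.
Qed.

(** If the reduction of [q] lay in the span of the other reductions, then q - y would be a multiple
    of [p] for some y in the span of [s]. A zero multiple puts [q] in the span of [s]; a nonzero one
    puts [p] in the span of [q :: s]. *)
Lemma lfree_reduce (p : vec) (a : K) i s : lfree (p :: s) ->
  lfree [seq q ++ scalev (- (coef q i / a)) p | q <- s].
Proof.
elim: s => //= q s IH [[sF qs] ps]; split.
  by apply: IH; split=> // h; apply: ps; exact: (lspan_cons q).
rewrite lspan_reduce => -[y ys h].
have e j : coef q j - y j = (coef q i - y i) / a * coef p j.
  have := h j; rewrite coef_cat coef_scalev => /eqP; rewrite -subr_eq0 => /eqP E.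
  by apply/eqP; rewrite -subr_eq0 -E; apply/eqP; ring.
have [c0|c0] := eqVneq ((coef q i - y i) / a) 0.
  apply: qs; apply: lspan_ext ys => j; apply/esym/eqP.
  by rewrite -subr_eq0 e c0 mul0r.
apply: ps; exists ((coef q i - y i) / a)^-1.
apply: lspan_ext (lspanZ (- ((coef q i - y i) / a)^-1) ys) => j.
apply: (mulfI c0); rewrite mulrBr mulVKf // -e mulNr mulrN mulVKf //; ring.
Qed.

Lemma lfree_elim1 i s : lfree s -> lfree (elim1 i s).
Proof.
elim: s => //= p s IH sF; case: eqP => [_|_]; last exact: lfree_reduce.
case: sF => [sF ps]; split; first exact: IH.
by rewrite lspan_elim1 => -[].
Qed.

(* The intersection of the span of [s] with the common kernel of the
   coordinates selected by [P]. *)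
Definition restrict (P : pred I) s : seq vec :=
  foldl (fun s i => elim1 i s) s
    (filter P (flatten [seq map snd v | v <- s])).

(** Finitely many eliminations suffice: a coordinate that occurs in no list of [s] vanishes on the
    whole span. *)
Lemma lspan_restrict (P : pred I) s x :
  lspan (restrict P s) x <-> lspan s x /\ forall i, P i -> x i = 0.
Proof.
have aux E t : lspan (foldl (fun s i => elim1 i s) t E) x <->
    lspan t x /\ forall i, i \in E -> x i = 0.
  elim: E t => [|i E IH] t /=; first by split=> [|[]].
  rewrite IH lspan_elim1; split=> [[[h hi] hE]|[h hE]].
    by split=> // j; rewrite inE => /orP[/eqP ->|/hE].
  split; first by split=> //; apply: hE; rewrite mem_head.
  by move=> j jE; apply: hE; rewrite inE jE orbT.
rewrite aux; split=> -[h hE]; split=> // i; last by rewrite mem_filter => /andP[/hE].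
move=> Pi; case iE: (i \in flatten [seq map snd v | v <- s]).
  by apply: hE; rewrite mem_filter Pi.
move: {aux hE} x h; apply: lspan_ind => [x y e <- //|//|v c x vs x0].
rewrite x0 coef_notin ?mulr0 ?addr0 //.
by apply: contraFN iE => iv; apply/flatten_mapP; exists v.
Qed.

Lemma lfree_restrict (P : pred I) s : lfree s -> lfree (restrict P s).
Proof.
rewrite /restrict; move: (filter P _) => E.
by elim: E s => //= i E IH s /(lfree_elim1 i)/IH.
Qed.

Lemma lspanP s x :
  lspan s x <-> exists c : nat -> K, forall i,
    x i = \sum_(k < size s) c k * coef (nth [::] s k) i.
Proof.
elim: s x => [|p s IH] x /=; split.
- by move=> h; exists (fun=> 0) => i; rewrite big_ord0 h.
- by case=> c h i; rewrite h big_ord0.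
- case=> c /IH[d h]; exists (fun k => if k is k'.+1 then d k' else c) => i.
  by rewrite big_ord_recl /= -h addrC subrK.
case=> c h; exists (c 0%N); apply/IH; exists (fun k => c k.+1) => i.
by rewrite h big_ord_recl /= addrAC subrr add0r.
Qed.

Lemma lfreeP s (c : nat -> K) : lfree s ->
  (forall i, \sum_(k < size s) c k * coef (nth [::] s k) i = 0) ->
  forall k, (k < size s)%N -> c k = 0.
Proof.
elim: s c => [|p s IH] //= c [sF ps] h.
have c0 : c 0%N = 0.
  apply/eqP/negP => /negP c0; apply: ps; apply/lspanP.
  exists (fun k => - c k.+1 / c 0%N) => i; apply: (mulfI c0).
  have := h i; rewrite big_ord_recl /= => /eqP; rewrite addr_eq0 => /eqP ->.
  by rewrite mulr_sumr -sumrN; apply: eq_bigr => k _ /=; field.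
case=> [|k] //; rewrite ltnS; apply: (IH (fun k => c k.+1)) => // i.
by have := h i; rewrite big_ord_recl c0 mul0r add0r.
Qed.

(** The coordinates [h a] form a dual family: the one of [a] vanishes on all other generators, hence
    on their span. *)
Lemma lfree_delta (T : eqType) (l : seq T) (g : T -> vec) (h : T -> I) :
  uniq l -> (forall a b, coef (g a) (h b) = (a == b)%:R) -> lfree (map g l).
Proof.
move=> + gh; elim: l => //= a l IH /andP[al /IH lF]; split=> // sp.
have : coef (g a) (h a) = 0.
  move: (coef (g a)) sp; apply: lspan_ind => [x y <-//|//|v c x /mapP[b bl ->] ->].
  rewrite gh; have [ba|_] := eqVneq b a; last by rewrite mulr0 addr0.
  by rewrite -ba bl in al.
by rewrite gh eqxx; move/eqP; rewrite oner_eq0.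
Qed.

End SparseVectors.

(** * The algorithm *)

Section Algorithm.
Variables (n : nat) (K : fieldType).
Local Notation X := 'X_{1..n}.
Local Notation wl := (seq (K * (X * X))).
Local Notation idx := (bool * (nat * (X * X)))%type.
Local Notation vec := (seq (K * idx)).
Local Notation sys := (nat * seq (seq wl))%type.

Definition wx (a : X) (l : wl) : wl :=
  [seq (t.1, ((t.2.1 + a)%MM, t.2.2)) | t <- l].

(* d_i . x^a d^b = x^a d^(b + e_i) + a_i x^(a - e_i) d^b, where the coefficient
   a_i is obtained by repeating the term. *)
Definition wd (i : 'I_n) (l : wl) : wl :=
  flatten [seq (t.1, (t.2.1, (t.2.2 + U_(i))%MM)) ::
    nseq (t.2.1 i) (t.1, ((t.2.1 - U_(i))%MM, t.2.2)) | t : K * (X * X) <- l].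

Definition wmon (a b : X) (l : wl) : wl := wx a (mnm_iter wd b l).

(* Left multiplication by the Euler operator Theta = \sum_i x_i d_i. *)
Definition wtheta (l : wl) : wl :=
  flatten [seq wx U_(i)%MM (wd i l) | i <- enum 'I_n].

(** Bounding the exponents one by one instead of the total degree gives exactly (k + 1)^n elements
    and a construction by n nested loops. *)
Definition box (k : nat) : seq X :=
  foldr (fun i s => [seq (z.2 + U_(i) *+ z.1)%MM |
           z <- [seq (e, m) | e <- iota 0 k.+1, m <- s]])
    [:: 0%MM] (enum 'I_n).

Definition tag (j : nat) (l : wl) : vec := [seq (t.1, (true, (j, t.2))) | t <- l].

(* P . x^a is the part free of the d_i of the product P x^a. *)
Definition wact (l : wl) (a : X) : wl :=
  [seq u <- flatten [seq scalev t.1 (wmon t.2.1 t.2.2 [:: (1, (a, 0%MM))]) | t <- l]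
     | u.2.2 == 0%MM].

Definition entry (S : sys) (i j : nat) : wl := nth [::] (nth [::] S.2 i) j.

(* The coordinates tagged [false] of a vector hold an unknown, those tagged
   [true] hold its image. *)
Definition solgen (S : sys) (j : nat) (a : X) : vec :=
  (1, (false, (j, (a, 0%MM)))) ::
  flatten [seq tag i (wact (entry S i j) a) | i <- iota 0 (size S.2)].

(** The generators span the graph of f -> L . f on vectors with exponents in the box. Killing the
    image coordinates leaves its kernel. *)
Definition solve (S : sys) (N : nat) : seq vec :=
  restrict (fun i => i.1)
    [seq solgen S z.1 z.2 | z <- [seq (j, a) | j <- iota 0 S.1, a <- box N]].

Definition unknown (j : nat) (v : vec) : seq (K * X) :=
  [seq (t.1, t.2.2.2.1) | t <- v & t.2 == (false, (j, (t.2.2.2.1, 0%MM)))].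

Definition output (S : sys) (N : nat) : seq (seq (seq (seq (K * X)))) :=
  [seq [seq [:: unknown j v] | j <- iota 0 S.1] | v <- solve S N].

(* An element of the span of the [certQ S i a b] and [certC j a b] with unknowns
   c_ab and zero image is an identity Q L + (\sum_ab c_ab x^a Theta^b) e_j = 0,
   where Theta = \sum_i x_i d_i; the operator Q itself is not recorded. *)
Definition certQ (S : sys) (i : nat) (a b : X) : vec :=
  flatten [seq tag j (wmon a b (entry S i j)) | j <- iota 0 S.1].

Definition certC (j : nat) (a : X) (b : nat) : vec :=
  (1, (false, (b, (a, 0%MM)))) ::
  tag j (wx a (iter b wtheta [:: (1, (0%MM, 0%MM))])).

Definition cert (S : sys) (j k : nat) : seq vec :=
  restrict (fun i => i.1)
   ([seq certQ S z.1 z.2.1 z.2.2 | z <- [seq (i, w) | i <- iota 0 (size S.2),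
        w <- [seq (a, b) | a <- box k, b <- box k]]] ++
    [seq certC j z.1 z.2 | z <- [seq (a, b) | a <- box k, b <- iota 0 k.+1]]).

(* The coefficients of c_a(T) = \sum_b c_ab T^b. *)
Definition colpoly (k : nat) (v : vec) (a : X) : seq K :=
  [seq coef v (false, (b, (a, 0%MM))) | b <- iota 0 k.+1].

(** The generous length [size p + size q] avoids a maximum. Trailing zeros change neither the
    polynomial nor the tests applied to it. *)
Definition padd (p q : seq K) : seq K :=
  [seq nth 0 p i + nth 0 q i | i <- iota 0 (size p + size q)].

(* The coefficients of p(T + 1). *)
Definition shift1 (p : seq K) : seq K :=
  foldr (fun c q => padd (c :: q) q) [::] p.

(** A classical truth value, which becomes computable through the clause [computable_natroot]. *)
Definition noroot (p : seq K) : bool :=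
  ~~ `[< exists k : nat, \sum_(i < size p) p`_i * k%:R ^+ i = 0 >].

(** Imposing the root condition on every nonzero column spares the program any comparison of
    monomials. *)
Definition check (N k : nat) (v : vec) : bool :=
  has (fun a => has (fun c => c != 0) (colpoly k v a)) (box k) &&
  all (fun a => all (fun c => c == 0) (colpoly k v a) ||
                noroot (iter N shift1 (colpoly k v a))) (box k).

(** The same [N] limits the levels tried and the degrees, so that a search over a single number
    explores both. *)
Definition bounded (S : sys) (N : nat) : bool :=
  all (fun j => has (fun k => has (check N k) (cert S j k)) (iota 0 N)) (iota 0 S.1).

End Algorithm.

(** * Programs for the algorithm over a computable field *)

Section TrackedAlgorithm.
Variables (n : nat) (K : fieldType).
Context {repK : Rep K}.
Hypothesis compK : computable_field repK.
Local Notation X := 'X_{1..n}.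
Local Notation wl := (seq (K * (X * X))).
Local Notation idx := (bool * (nat * (X * X)))%type.
Local Notation vec := (seq (K * idx)).
Local Notation sys := (nat * seq (seq wl))%type.

Lemma tr_size (G : Type) {RG : Rep G} (A : Type) {RA : Rep A} (s : G -> seq A) :
  tracked s -> tracked (fun x => size (s x)).
Proof.
move=> sT; apply: (tracked_ext (f := fun x => foldr (fun _ => S) 0%N (s x))) => //.
by apply: (tr_foldr (h := fun _ _ => S)); trk.
Qed.

Lemma tr_pairs (G : Type) {RG : Rep G} (A B : Type) {RA : Rep A} {RB : Rep B}
    (s : G -> seq A) (t : G -> seq B) :
  tracked s -> tracked t ->
  tracked (fun x => [seq (a, b) | a <- s x, b <- t x]).
Proof.
move=> sT tT; apply: (tr_comp2 (h := fun s t => [seq (a, b) | a <- s, b <- t])) sT tT.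
by rewrite /allpairs_dep; trk.
Qed.

Lemma tr_K (G : Type) {RG : Rep G} (c : K) : tracked (fun _ : G => c).
Proof. by apply: tr_const; exact: (computable_surj compK). Qed.

Lemma tr_addK (G : Type) {RG : Rep G} (f g : G -> K) :
  tracked f -> tracked g -> tracked (fun x => f x + g x).
Proof.
apply: (tr_comp2 (h := fun a b : K => a + b)).
have [p hp] := computable_add compK.
by exists p => -[|t u] [a b] // [ta ub]; exact: hp.
Qed.

Lemma tr_mulK (G : Type) {RG : Rep G} (f g : G -> K) :
  tracked f -> tracked g -> tracked (fun x => f x * g x).
Proof.
apply: (tr_comp2 (h := fun a b : K => a * b)).
have [p hp] := computable_mul compK.
by exists p => -[|t u] [a b] // [ta ub]; exact: hp.
Qed.

Lemma tr_oppK (G : Type) {RG : Rep G} (f : G -> K) :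
  tracked f -> tracked (fun x => - f x).
Proof.
move=> fT; apply: (tracked_ext (f := fun x => -1 * f x)).
  by move=> x; rewrite mulN1r.
by apply: tr_mulK => //; exact: tr_K.
Qed.

Lemma tr_neq0K (G : Type) {RG : Rep G} (f : G -> K) :
  tracked f -> tracked (fun x => f x != 0).
Proof.
apply: (tr_comp (g := fun a : K => a != 0)).
have [p hp] := computable_eq0 compK.
exists p => t a /hp[v pv hv]; exists v => //.
by case: v hv {pv} => [|u v] /= hv; [apply/negbF/eqP/hv|apply/eqP => /hv].
Qed.

Lemma tr_eq0K (G : Type) {RG : Rep G} (f : G -> K) :
  tracked f -> tracked (fun x => f x == 0).
Proof.
move=> /tr_neq0K/tr_neg; apply: tracked_ext => x; exact: negbK.
Qed.

(** The division program is specified for nonzero divisors only, whereas a / 0 is 0 here. The zero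
    test separates the two cases. *)
Lemma tr_divK (G : Type) {RG : Rep G} (f g : G -> K) :
  tracked f -> tracked g -> tracked (fun x => f x / g x).
Proof.
apply: (tr_comp2 (h := fun a b : K => a / b)).
have [q hq] := tr_eq0K (tr_snd (tr_id (G := K * K))).
have [r hr] := tr_K (G := K * K) 0.
have [p hp] := computable_div compK.
exists (PIf q r p) => -[|t u] // [a b] tu.
have [[|c1 c2] qc] := hq _ _ tu => /eqP b0.
  have [v pv rv] : exists2 v, runs p (Node t u) v & repK v (a / b).
    by case: tu => ta ub; apply: hp => //; apply/eqP.
  by exists v => //; exact: RIfF.
have [v rv hv] := hr _ _ tu; exists v; first exact: RIfT qc rv.
by move: b0 => /= ->; rewrite invr0 mulr0.
Qed.

Ltac trk_field :=
  lazymatch goal with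
  | |- tracked (fun x => @GRing.zero _) => exact (tr_K 0)
  | |- tracked (fun x => @GRing.one _) => exact (tr_K 1)
  | |- tracked (fun x => (_ / _)%R) => eapply tr_divK
  | |- tracked (fun x => (_ + _)%R) => eapply tr_addK
  | |- tracked (fun x => (_ * _)%R) => eapply tr_mulK
  | |- tracked (fun x => (- _)%R) => eapply tr_oppK
  | |- tracked (fun x => eq_op _ 0%R) => eapply tr_eq0K
  | |- tracked (fun x => negb (eq_op _ 0%R)) => eapply tr_neq0K
  | |- tracked (fun x => size _) => eapply tr_size
  | |- tracked (fun x => allpairs_dep pair _ _) => eapply tr_pairs
  end.
Ltac trk_more ::= first [trk_field | trk_library].

Lemma tr_noroot (G : Type) {RG : Rep G} (f : G -> seq K) :
  tracked f -> tracked (fun x => noroot (f x)).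
Proof.
apply: (tr_comp (g := @noroot K)).
have [p hp] := computable_natroot compK.
exists p => t a /hp[v pv hv]; exists v => //.
by case: v hv {pv} => [|u v] /= hv; [apply/negbF/asboolP/hv|apply/asboolP => /hv].
Qed.

Section Vectors.
Variable I : eqType.
Context {RI : Rep I}.
Hypothesis eqT : tracked (fun z : I * I => z.1 == z.2).

Lemma tr_coef (G : Type) {RG : Rep G} (f : G -> seq (K * I)) (g : G -> I) :
  tracked f -> tracked g -> tracked (fun x => coef (f x) (g x)).
Proof.
apply: (tr_comp2 (h := @coef K I)); rewrite /coef; eapply tr_foldr; [|trk|trk].
by apply: tr_if; [apply: (tr_comp2 eqT)| |]; trk.
Qed.

Lemma tr_scalev (J : eqType) {RJ : Rep J} (G : Type) {RG : Rep G}
    (f : G -> K) (g : G -> seq (K * J)) :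
  tracked f -> tracked g -> tracked (fun x => scalev (f x) (g x)).
Proof. by apply: (tr_comp2 (h := @scalev K J)); rewrite /scalev; trk. Qed.

Lemma tr_elim1 (G : Type) {RG : Rep G} (f : G -> I) (g : G -> seq (seq (K * I))) :
  tracked f -> tracked g -> tracked (fun x => elim1 (f x) (g x)).
Proof.
apply: (tr_comp2 (h := @elim1 K I)).
(* [elim1] uses the unprocessed tail, which a fold does not see. The fold therefore rebuilds the
   tail as the first component of its result. *)
apply: (tracked_ext (f := fun z => (foldr (fun p b => (p :: b.1,
  if coef p z.1 == 0 then p :: b.2 else
  [seq q ++ scalev (- (coef q z.1 / coef p z.1)) p | q <- b.1])) ([::], [::]) z.2).2)).
  case=> i s /=.
  set F := foldr _ _; suff -> : F s = (s, elim1 i s) by [].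
  by elim: s => //= p s ->.
apply: tr_snd; eapply tr_foldr; [|trk|trk].
apply: tr_pair; first by trk.
apply: tr_if; [apply: tr_eq0K; apply: tr_coef; trk|trk|].
eapply tr_map; last by trk.
apply: tr_cat; first by trk.
apply: tr_scalev; last by trk.
by apply: tr_oppK; apply: tr_divK; apply: tr_coef; trk.
Qed.

Lemma tr_restrict (P : pred I) (G : Type) {RG : Rep G}
    (f : G -> seq (seq (K * I))) :
  tracked P -> tracked f -> tracked (fun x => restrict P (f x)).
Proof.
move=> PT; apply: (tr_comp (g := @restrict K I P)); rewrite /restrict.
eapply tr_foldl; [apply: tr_elim1; trk|trk|].
apply: (tr_filter (h := fun _ => P)); last by trk.
by apply: (tr_comp PT); trk.
Qed.

End Vectors.

Lemma tr_wx (G : Type) {RG : Rep G} (f : G -> X) (g : G -> wl) :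
  tracked f -> tracked g -> tracked (fun x => wx (f x) (g x)).
Proof. by apply: (tr_comp2 (h := @wx n K)); rewrite /wx; trk. Qed.

Lemma tr_wd i (G : Type) {RG : Rep G} (g : G -> wl) :
  tracked g -> tracked (fun x => wd i (g x)).
Proof. by apply: (tr_comp (g := wd i)); rewrite /wd; trk. Qed.

Lemma tr_wmon (G : Type) {RG : Rep G} (f g : G -> X) (h : G -> wl) :
  tracked f -> tracked g -> tracked h -> tracked (fun x => wmon (f x) (g x) (h x)).
Proof.
apply: (tr_comp3 (h := @wmon n K)); apply: tr_wx; first by trk.
rewrite /mnm_iter.
apply: (tr_foldr_const (h := fun i (z : X * X * wl) => iter (z.1.2 i) (@wd n K i)));
  last by trk.
by move=> i; apply: (tr_iter (h := fun _ => @wd n K i)); [apply: tr_wd| |]; trk.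
Qed.

Lemma tr_wtheta (G : Type) {RG : Rep G} (g : G -> wl) :
  tracked g -> tracked (fun x => wtheta (g x)).
Proof.
apply: (tr_comp (g := @wtheta n K)); apply: tr_flatten.
apply: (tr_map_const (h := fun i l => wx U_(i)%MM (@wd n K i l))) => i.
by apply: tr_wx; [|apply: tr_wd]; trk.
Qed.

Lemma tr_box (G : Type) {RG : Rep G} (k : G -> nat) :
  tracked k -> tracked (fun x => box n (k x)).
Proof.
apply: (tr_comp (g := box n)); rewrite /box.
apply: (tr_foldr_const (h := fun i k s => [seq (z.2 + U_(i) *+ z.1)%MM |
           z <- [seq (e, m) | e <- iota 0 k.+1, m <- s]])); last by trk.
by move=> i; trk.
Qed.

Lemma tr_tag (G : Type) {RG : Rep G} (j : G -> nat) (g : G -> wl) :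
  tracked j -> tracked g -> tracked (fun x => tag (j x) (g x)).
Proof. by apply: (tr_comp2 (h := @tag n K)); rewrite /tag; trk. Qed.

Ltac trk_weyl :=
  lazymatch goal with
  | |- tracked (fun x => scalev _ _) => eapply tr_scalev
  | |- tracked (fun x => coef _ _) => eapply tr_coef
  | |- tracked (fun x => restrict _ _) => eapply tr_restrict
  | |- tracked (fun x => wx _ _) => eapply tr_wx
  | |- tracked (fun x => wmon _ _ _) => eapply tr_wmon
  | |- tracked (fun x => wtheta _) => eapply tr_wtheta
  | |- tracked (fun x => box _ _) => eapply tr_box
  | |- tracked (fun x => tag _ _) => eapply tr_tag
  | |- tracked (fun x => noroot _) => eapply tr_noroot
  end.
Ltac trk_more ::= first [trk_weyl | trk_field | trk_library].

Lemma tr_wact (G : Type) {RG : Rep G} (l : G -> wl) (a : G -> X) :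
  tracked l -> tracked a -> tracked (fun x => wact (l x) (a x)).
Proof. by apply: (tr_comp2 (h := @wact n K)); rewrite /wact; trk. Qed.

Lemma tr_entry (G : Type) {RG : Rep G} (S : G -> sys) (i j : G -> nat) :
  tracked S -> tracked i -> tracked j -> tracked (fun x => entry (S x) (i x) (j x)).
Proof. by apply: (tr_comp3 (h := @entry n K)); rewrite /entry; trk. Qed.

Lemma tr_solgen (G : Type) {RG : Rep G} (S : G -> sys) (j : G -> nat) (a : G -> X) :
  tracked S -> tracked j -> tracked a -> tracked (fun x => solgen (S x) (j x) (a x)).
Proof.
apply: (tr_comp3 (h := @solgen n K)); rewrite /solgen.
apply: tr_cons; first by trk.
apply: tr_flatten; eapply tr_map; last by trk.
by apply: tr_tag; [|apply: tr_wact; [apply: tr_entry|]]; trk.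
Qed.

Lemma tr_solve (G : Type) {RG : Rep G} (S : G -> sys) (N : G -> nat) :
  tracked S -> tracked N -> tracked (fun x => solve (S x) (N x)).
Proof.
apply: (tr_comp2 (h := @solve n K)); rewrite /solve.
apply: tr_restrict; [by trk|by trk|].
by eapply tr_map; [apply: tr_solgen|]; trk.
Qed.

Lemma tr_output (G : Type) {RG : Rep G} (S : G -> sys) (N : G -> nat) :
  tracked S -> tracked N -> tracked (fun x => output (S x) (N x)).
Proof.
apply: (tr_comp2 (h := @output n K)); rewrite /output /unknown.
by eapply tr_map; [|apply: tr_solve]; trk.
Qed.

Lemma tr_certQ (G : Type) {RG : Rep G} (S : G -> sys) (i : G -> nat) (a b : G -> X) :
  tracked S -> tracked i -> tracked a -> tracked b ->
  tracked (fun x => certQ (S x) (i x) (a x) (b x)).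
Proof.
apply: (tr_comp4 (h := @certQ n K)); rewrite /certQ.
apply: tr_flatten; eapply tr_map; last by trk.
by apply: tr_tag; [|apply: tr_wmon; [| |apply: tr_entry]]; trk.
Qed.

Lemma tr_certC (G : Type) {RG : Rep G} (j : G -> nat) (a : G -> X) (b : G -> nat) :
  tracked j -> tracked a -> tracked b ->
  tracked (fun x => certC K (j x) (a x) (b x)).
Proof. by apply: (tr_comp3 (h := @certC n K)); rewrite /certC; trk. Qed.

Lemma tr_cert (G : Type) {RG : Rep G} (S : G -> sys) (j k : G -> nat) :
  tracked S -> tracked j -> tracked k -> tracked (fun x => cert (S x) (j x) (k x)).
Proof.
apply: (tr_comp3 (h := @cert n K)); rewrite /cert.
apply: tr_restrict; [by trk|by trk|apply: tr_cat].
  by eapply tr_map; [apply: tr_certQ|]; trk.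
by eapply tr_map; [apply: tr_certC|]; trk.
Qed.

Lemma tr_shift1 (G : Type) {RG : Rep G} (p : G -> seq K) :
  tracked p -> tracked (fun x => shift1 (p x)).
Proof. by apply: (tr_comp (g := @shift1 K)); rewrite /shift1 /padd; trk. Qed.

Lemma tr_colpoly (G : Type) {RG : Rep G} (k : G -> nat) (v : G -> vec) (a : G -> X) :
  tracked k -> tracked v -> tracked a -> tracked (fun x => colpoly (k x) (v x) (a x)).
Proof. by apply: (tr_comp3 (h := @colpoly n K)); rewrite /colpoly; trk. Qed.

Lemma tr_check (G : Type) {RG : Rep G} (N k : G -> nat) (v : G -> vec) :
  tracked N -> tracked k -> tracked v -> tracked (fun x => check (N x) (k x) (v x)).
Proof.
apply: (tr_comp3 (h := @check n K)); rewrite /check; apply: tr_and.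
  by eapply tr_has; [eapply tr_has; [|apply: tr_colpoly]|]; trk.
eapply tr_all; last by trk.
apply: tr_or; first by eapply tr_all; [|apply: tr_colpoly]; trk.
apply: tr_noroot; apply: (tr_iter (h := fun _ => @shift1 K)); [|trk|apply: tr_colpoly; trk].
by apply: tr_shift1; trk.
Qed.

Lemma tr_bounded (G : Type) {RG : Rep G} (S : G -> sys) (N : G -> nat) :
  tracked S -> tracked N -> tracked (fun x => bounded (S x) (N x)).
Proof.
apply: (tr_comp2 (h := @bounded n K)); rewrite /bounded.
eapply tr_all; last by trk.
eapply tr_has; last by trk.
by eapply tr_has; [apply: tr_check|apply: tr_cert]; trk.
Qed.

End TrackedAlgorithm.

(** * Lists of terms as differential operators *)

Section WeylLists.
Variables (n : nat) (K : fieldType).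
Local Notation X := 'X_{1..n}.
Local Notation wl := (seq (K * (X * X))).
Local Notation A := {mpoly K[n]}.
Local Notation W := {mpoly {mpoly K[n]}[n]}.

Definition wsem (l : wl) : W := \sum_(t <- l) (t.1 *: 'X_[t.2.1] : A) *: 'X_[t.2.2].

Definition psem (l : seq (K * X)) : A := \sum_(t <- l) t.1 *: 'X_[t.2].

(** One type carries two products, that of operators on [weyl n K] and the commutative one on [W].
    Left multiplication by a constant is where they agree with scaling, and this allows passing from
    one to the other. *)
Lemma weylCE (c : K) (q : weyl n K) : weylC n c * q = c%:MP *: (q : W).
Proof.
rewrite /weylC -[LHS]/(weyl_mul _ _).
rewrite -(mulr1 (c%:MP_[n])%:MP_[n]) mul_mpolyC -mpolyX0.
by rewrite weyl_mulZX mnm_iter0.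
Qed.

Lemma weyl_monomE (a b : X) : weyl_monom K a b = ('X_[a] : A) *: ('X_[b] : W).
Proof. by []. Qed.

Lemma rep_weyl_sumE (l : wl) :
  \sum_(z <- l) weylC n z.1 * weyl_monom K z.2.1 z.2.2 = wsem l :> weyl n K.
Proof.
apply: eq_bigr => z _; rewrite weylCE weyl_monomE scalerA.
by rewrite mul_mpolyC.
Qed.

Lemma wsem_cat (l1 l2 : wl) : wsem (l1 ++ l2) = wsem l1 + wsem l2.
Proof. by rewrite /wsem big_cat. Qed.

Lemma wsem_flatten (T : Type) (s : seq T) (f : T -> wl) :
  wsem (flatten [seq f x | x <- s]) = \sum_(x <- s) wsem (f x).
Proof.
elim: s => [|x s IH]; rewrite ?(big_nil, big_cons) /=; first by rewrite /wsem big_nil.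
by rewrite wsem_cat IH.
Qed.

Lemma wsem_scalev c (l : wl) : wsem (scalev c l) = c%:MP *: wsem l.
Proof.
rewrite /wsem big_map scaler_sumr; apply: eq_bigr => t _ /=.
by rewrite scalerA mul_mpolyC scalerA.
Qed.

Lemma wsem_wx a (l : wl) : wsem (wx a l) = ('X_[a] : A) *: wsem l.
Proof.
rewrite /wsem big_map scaler_sumr; apply: eq_bigr => t _ /=.
by rewrite scalerA -scalerAr -mpolyXD addmC.
Qed.

Lemma weyl_dmul0 i : weyl_dmul i (0 : W) = 0.
Proof. by rewrite /weyl_dmul msupp0 big_nil. Qed.

Lemma wsem_wd i (l : wl) : wsem (wd i l) = weyl_dmul i (wsem l).
Proof.
rewrite /wd wsem_flatten; elim: l => [|t l IH].
  by rewrite big_nil /wsem big_nil weyl_dmul0.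
rewrite big_cons IH [in RHS]/wsem big_cons weyl_dmulD weyl_dmulZX; congr (_ + _).
rewrite /wsem big_cons /=; congr (_ + _).
rewrite mderivZ mderivX -/(wsem _).
elim: (t.2.1 i) => [|k IHk]; first by rewrite /wsem big_nil scale0r scaler0 scale0r.
rewrite -[nseq _ _]/(_ :: nseq k _) /wsem big_cons -/(wsem _) IHk /=.
by rewrite -add1n natrD [in RHS]scalerDl scale1r scalerDr scalerDl.
Qed.

Lemma wsem_mnm_iter b (l : wl) :
  wsem (mnm_iter (@wd n K) b l) = mnm_iter (@weyl_dmul n K) b (wsem l).
Proof.
rewrite /mnm_iter; elim: (enum _) => //= i s <-.
by elim: (b i) => //= k <-; rewrite wsem_wd.
Qed.

Lemma wsem_wmon a b (l : wl) :
  wsem (wmon a b l) = weyl_mul (weyl_monom K a b) (wsem l).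
Proof. by rewrite wsem_wx wsem_mnm_iter weyl_mulZX. Qed.

Lemma wsem_wtheta (l : wl) :
  wsem (wtheta l) = \sum_i 'X_[U_(i)%MM] *: weyl_dmul i (wsem l).
Proof.
rewrite /wtheta wsem_flatten big_enum /=.
by apply: eq_bigr => i _; rewrite wsem_wx wsem_wd.
Qed.

Lemma wsem_coef (l : wl) a b :
  (wsem l)@_b@_a = \sum_(t <- l | t.2 == (a, b)) t.1.
Proof.
rewrite /wsem raddf_sum /= raddf_sum [RHS]big_mkcond /=.
apply: eq_bigr => t _; rewrite mcoeffZ mcoeffX.
have -> : (t.2 == (a, b)) = (t.2.1 == a) && (t.2.2 == b) by case: (t.2).
case: (t.2.2 == b); last by rewrite mulr0 mcoeff0 andbF.
by rewrite mulr1 mcoeffZ mcoeffX andbT; case: eqP; rewrite ?mulr1 ?mulr0.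
Qed.

Lemma coef_tag j (l : wl) k j' a b :
  coef (tag j l) (k, (j', (a, b))) =
  if k && (j == j') then (wsem l)@_b@_a else 0.
Proof.
rewrite coefE big_map wsem_coef; case: ifP => [/andP[-> /eqP ->]|h].
  by apply: eq_bigl => t; rewrite !xpair_eqE !eqxx; case: (t.2).
by rewrite big_pred0 // => t; rewrite !xpair_eqE andbA [true == k]eq_sym eqb_id h.
Qed.

Let delM := @mderivM n K.
Let delC i j (a : A) : a^`M(j)^`M(i) = a^`M(i)^`M(j) := mderiv_comm j i a.

Lemma weyl_actT i (p : W) f : weyl_act (weyl_dmul i p) f = (weyl_act p f)^`M(i).
Proof.
exact: (ore_actT delM delC (@weyl_addind n K) (@weyl_dmulD n K) (@weyl_dmulZX n K)
  (@weyl_actD n K) (@weyl_actZX n K) (@mderivD n K)).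
Qed.

Lemma weyl_actZ a (p : W) f : weyl_act (a *: p) f = a * weyl_act p f.
Proof. exact: (ore_actZ (@weyl_addind n K) (@weyl_actD n K) (@weyl_actZX n K)). Qed.

Lemma weyl_act0l f : weyl_act (0 : weyl n K) f = 0.
Proof. by rewrite /weyl_act msupp0 big_nil. Qed.

Lemma weyl_actDr (p : weyl n K) f g : weyl_act p (f + g) = weyl_act p f + weyl_act p g.
Proof.
rewrite /weyl_act -big_split; apply: eq_bigr => b _.
by rewrite raddfD mulrDr.
Qed.

Lemma weyl_act0r (p : weyl n K) : weyl_act p 0 = 0.
Proof. by rewrite /weyl_act big1 // => b _; rewrite raddf0 mulr0. Qed.

Lemma weyl_actZr (p : weyl n K) (c : K) f : weyl_act p (c *: f) = c *: weyl_act p f.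
Proof.
rewrite /weyl_act scaler_sumr; apply: eq_bigr => b _.
by rewrite linearZ scalerAr.
Qed.

Lemma weyl_act_sumr (p : weyl n K) (T : Type) (s : seq T) (f : T -> A) :
  weyl_act p (\sum_(x <- s) f x) = \sum_(x <- s) weyl_act p (f x).
Proof.
elim: s => [|x s IH]; rewrite ?(big_nil, big_cons) ?weyl_act0r //.
by rewrite weyl_actDr IH.
Qed.

Lemma weyl_act_suml (T : Type) (s : seq T) (p : T -> weyl n K) f :
  weyl_act (\sum_(x <- s) p x) f = \sum_(x <- s) weyl_act (p x) f.
Proof.
elim: s => [|x s IH]; rewrite ?(big_nil, big_cons) ?weyl_act0l //.
by rewrite weyl_actD IH.
Qed.

(** P . x^a equals (P x^a) . 1 by [weyl_actM], and on the constant 1 all terms with a derivation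
    vanish. *)
Lemma psem_wact (l : wl) a :
  psem [seq (t.1, t.2.1) | t <- wact l a] = weyl_act (wsem l) 'X_[a].
Proof.
have act1 (l' : wl) : psem [seq (t.1, t.2.1) | t <- l' & t.2.2 == 0%MM] =
    weyl_act (wsem l') 1.
  rewrite /psem big_map big_filter [RHS]weyl_act_suml big_mkcond /=.
  apply: eq_bigr => t _; rewrite weyl_actZX.
  case: eqP => [->|/eqP b0]; first by rewrite mnm_iter0 mulr1.
  have [i bi] : exists i, t.2.2 i != 0%N.
    apply/existsP; rewrite -negb_forall; apply: contra b0 => /forallP h.
    by apply/eqP/mnmP => i; rewrite mnm0E; apply/eqP.
  have -> : t.2.2 = (t.2.2 - U_(i) + U_(i))%MM by rewrite submK // lep1mP.
  rewrite (mnm_iterDU delC).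
  have const b : exists c, mnm_iter (@mderiv n K) b 1 = c%:MP.
    elim/mnm_addind: b => [|b k [c hc]]; first by exists 1; rewrite mnm_iter0.
    by exists 0; rewrite (mnm_iterDU delC) hc mderivC.
  by have [c ->] := const (t.2.2 - U_(i))%MM; rewrite mderivC mulr0.
rewrite /wact act1 wsem_flatten.
have -> : \sum_(t <- l) wsem (scalev t.1 (wmon t.2.1 t.2.2 [:: (1, (a, 0%MM))])) =
    weyl_mul (wsem l) ('X_[a] *: 'X_[0%MM]).
  have h : wsem [:: (1, (a, 0%MM))] = 'X_[a] *: 'X_[0%MM].
    by rewrite /wsem big_seq1 scale1r.
  elim: l => [|t l IH]; first by rewrite /wsem !big_nil /weyl_mul msupp0 big_nil.
  rewrite /wsem !big_cons IH weyl_mulDl; congr (_ + _).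
  by rewrite -/(wsem _) wsem_scalev wsem_wmon h !weyl_mulZX scalerA mul_mpolyC.
rewrite [LHS](weyl_actM (wsem l) ('X_[a] *: 'X_[0%MM] : W) 1).
by rewrite weyl_actZX mnm_iter0 mulr1.
Qed.

Definition euler (f : A) : A := \sum_i 'X_[U_(i)%MM] * f^`M(i).

Lemma euler_coef f m : (euler f)@_m = (mdeg m)%:R * f@_m.
Proof.
rewrite /euler raddf_sum /= mdegE natr_sum mulr_suml; apply: eq_bigr => i _.
elim/mpolyind: f => [|c k p _ _ IH]; first by rewrite raddf0 mulr0 mcoeff0 mulr0.
rewrite raddfD mulrDr /= !mcoeffD IH mulrDr; congr (_ + _).
rewrite mderivZ mderivX -scalerAr !mcoeffZ mcoeffX -scalerAr -mpolyXD mcoeffZ mcoeffX.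
(* If [k i] is 0, truncated subtraction makes [k - U_(i) + U_(i)] differ from [k], but the factor
   [k i] vanishes. *)
have [k0|k0] := posnP (k i).
  by rewrite k0 mul0r mulr0; case: eqP => [<-|]; rewrite ?mulr0 // k0 mul0r.
rewrite addmC submK; last by rewrite lep1mP -lt0n.
by case: eqP => [->|_]; rewrite ?mulr0 // !mulr1 mulrC.
Qed.

Lemma weyl_act_cert a b f :
  weyl_act (wsem (wx a (iter b (@wtheta n K) [:: (1, (0%MM, 0%MM))]))) f =
  'X_[a] * iter b euler f.
Proof.
rewrite wsem_wx weyl_actZ; congr (_ * _).
elim: b => [|b IH] /=.
  by rewrite /wsem big_seq1 scale1r weyl_actZX mpolyX0 mul1r mnm_iter0.
rewrite -IH wsem_wtheta [LHS]weyl_act_suml; apply: eq_bigr => i _.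
by rewrite weyl_actZ weyl_actT.
Qed.

Lemma iter_euler_coef b f m : (iter b euler f)@_m = (mdeg m)%:R ^+ b * f@_m.
Proof.
by elim: b => [|b IH]; rewrite ?mul1r //= euler_coef IH mulrA -exprS.
Qed.

Definition tdeg (k : nat) (l : wl) : bool :=
  all (fun t : K * (X * X) => mdeg t.2.1 + mdeg t.2.2 <= k)%N l.

Lemma tdeg_wx k a l : tdeg k l -> tdeg (mdeg a + k) (wx a l).
Proof.
move=> /allP h; apply/allP => _ /mapP[t /h ht ->] /=.
by rewrite mdegD addnAC addnC leq_add2l.
Qed.

Lemma tdeg_wd k i l : tdeg k l -> tdeg k.+1 (wd i l).
Proof.
move=> /allP h; apply/allP => u /flatten_mapP[t /h ht].
rewrite inE => /orP[/eqP ->|/nseqP[-> _]] /=.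
  by rewrite mdegD mdeg1 addn1 addnS.
by apply: leq_trans (leqW ht); rewrite leq_add2r mdegB.
Qed.

Lemma tdeg_wtheta k l : tdeg k l -> tdeg k.+2 (wtheta l).
Proof.
move=> h; apply/allP => u /flatten_mapP[i hi ui].
have /allP := tdeg_wx U_(i)%MM (tdeg_wd i h); rewrite mdeg1; exact.
Qed.

Lemma tdeg_cert a b :
  tdeg (mdeg a + b.*2) (wx a (iter b (@wtheta n K) [:: (1, (0%MM, 0%MM))])).
Proof.
apply: tdeg_wx; elim: b => [|b IH]; first by rewrite /tdeg /= mdeg0.
exact: tdeg_wtheta.
Qed.

Lemma wsem_tdeg k l a b : tdeg k l -> (wsem l)@_b@_a != 0 -> (mdeg a + mdeg b <= k)%N.
Proof.
move=> /allP h; rewrite wsem_coef; apply: contraR => k_lt.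
rewrite big_seq_cond big1 // => t /andP[/h + /eqP e].
by rewrite e /= (negPf k_lt).
Qed.

End WeylLists.

(** * Natural roots and boxes of exponents *)

Section NaturalRoots.
Variable K : fieldType.
Implicit Types p q : seq K.

Lemma sum_Poly p (x : K) : \sum_(i < size p) p`_i * x ^+ i = (Poly p).[x].
Proof.
rewrite (horner_coef_wide _ (size_Poly p)).
by apply: eq_bigr => i _; rewrite coef_Poly.
Qed.

Lemma Poly_eq0 p : (Poly p == 0) = all (fun c => c == 0) p.
Proof.
apply/eqP/allP => [p0 c /(nthP 0)[i _ <-]|h].
  by rewrite -coef_Poly p0 coef0.
apply/polyP => i; rewrite coef_Poly coef0.
have [lt_i|le_i] := ltnP i (size p); last by rewrite nth_default.
exact/eqP/h/mem_nth.
Qed.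

Lemma Poly_padd p q : Poly (padd p q) = Poly p + Poly q.
Proof.
apply/polyP => i; rewrite coefD !coef_Poly.
have [lt_i|le_i] := ltnP i (size p + size q).
  by rewrite (nth_map 0%N) ?size_iota // nth_iota.
rewrite !nth_default ?addr0 ?size_map ?size_iota //; apply: leq_trans le_i.
  exact: leq_addl.
exact: leq_addr.
Qed.

(** Horner's rule: c + T q(T) becomes c + (T + 1) q(T + 1), which is the sum formed by [padd]. *)
Lemma Poly_shift1 p : Poly (shift1 p) = Poly p \Po ('X + 1%:P).
Proof.
elim: p => [|c p IH]; first by rewrite comp_poly0.
rewrite -[shift1 _]/(padd (c :: shift1 p) (shift1 p)) Poly_padd.
rewrite -![Poly (_ :: _)]/(cons_poly _ (Poly _)) !cons_poly_def IH comp_polyD.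
rewrite comp_polyM comp_polyX comp_polyC.
by rewrite mulrDr mulr1 addrAC.
Qed.

Lemma horner_shift N p k : (Poly (iter N (@shift1 K) p)).[k%:R] = (Poly p).[(k + N)%:R].
Proof.
elim: N k => [|N IH] k; first by rewrite addn0.
by rewrite iterS Poly_shift1 horner_comp !hornerE natr1 IH addSnnS.
Qed.

Lemma noroot_shiftP N p : reflect (forall k, (N <= k)%N -> (Poly p).[k%:R] != 0)
  (noroot (iter N (@shift1 K) p)).
Proof.
apply: (iffP idP) => [h k Nk|h].
  apply: contra h => /eqP h; apply/asboolP; exists (k - N)%N.
  by rewrite sum_Poly horner_shift subnK.
apply/asboolP => -[k]; rewrite sum_Poly horner_shift; apply/eqP/h.
exact: leq_addl.
Qed.

Hypothesis char0 : forall k : nat, k%:R = 0 :> K -> k = 0%N.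

(** Induction on the degree, splitting off the factor of one natural root. By [char0] this factor
    has no other natural root. *)
Lemma natural_roots_bounded (p : {poly K}) : p != 0 ->
  exists N, forall k, (N <= k)%N -> p.[k%:R] != 0.
Proof.
have [m] := ubnP (size p); elim: m p => // m IH p le_m p0.
have [[k pk]|h] := EM (exists k : nat, p.[k%:R] = 0); last first.
  by exists 0%N => k _; apply/eqP => pk; apply: h; exists k.
have /factor_theorem[q pE] : root p k%:R by apply/eqP.
have q0 : q != 0 by apply: contra_neq p0 => q0; rewrite pE q0 mul0r.
have [|N hN] := IH q _ q0.
  by move: le_m; rewrite pE size_Mmonic ?monicXsubC // size_XsubC addn2 ltnS.
exists (maxn N k.+1) => l; rewrite geq_max => /andP[Nl kl].
rewrite pE hornerM mulf_neq0 ?hN // !hornerE subr_eq0.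
apply/eqP => e; have /char0 : (l - k)%:R = 0 :> K.
  by rewrite natrB ?(ltnW kl) // e subrr.
by move/eqP; rewrite subn_eq0 leqNgt kl.
Qed.

End NaturalRoots.

Section Box.
Variable n : nat.
Local Notation X := 'X_{1..n}.

Lemma mem_box k (m : X) : (m \in box n k) = [forall i, m i <= k]%N.
Proof.
rewrite /box; have EP e : (e \in iota 0 k.+1) = (e <= k)%N by rewrite mem_iota.
move: (iota 0 k.+1) EP (iota_uniq 0 k.+1) => E EP uE.
have aux s : uniq s -> forall m : X, (m \in foldr (fun i s =>
    [seq (z.2 + U_(i) *+ z.1)%MM | z <- [seq (e, m) | e <- E, m <- s]])
    [:: 0%MM] s) = [forall i, m i <= (if i \in s then k else 0)]%N.
  elim: s => [_ m'|i s IH /= /andP[is_ us] m'].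
    rewrite inE; apply/eqP/forallP => [-> i|h]; first by rewrite mnm0E.
    by apply/mnmP => i; apply/eqP; rewrite mnm0E -leqn0 (h i).
  apply/mapP/forallP => [[z /allpairsPdep[e [u [+ + ->]]] ->] l /=|h].
    rewrite EP (IH us) => ek /forallP/(_ l).
    rewrite mnmDE mulmnE mnm1E inE [l == i]eq_sym.
    case: eqP => [<-|_] /=; last by rewrite mul0n addn0.
    by rewrite (negPf is_) leqn0 mul1n => /eqP ->.
  exists (m' i, (m' - U_(i) *+ m' i)%MM) => /=.
    apply/allpairsPdep; exists (m' i), (m' - U_(i) *+ m' i)%MM; split=> //.
      by rewrite EP; have := h i; rewrite mem_head.
    rewrite (IH us); apply/forallP => l; have := h l.
    rewrite mnmBE mulmnE mnm1E inE [l == i]eq_sym.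
    case: eqP => [<-|_] /=; last by rewrite mul0n subn0.
    by rewrite mul1n subnn.
  apply/mnmP => l; rewrite mnmDE mnmBE mulmnE mnm1E.
  by case: eqP => [<-|_]; rewrite ?mul0n ?mul1n ?subn0 ?addn0 // subnn.
rewrite (aux _ (enum_uniq _)); apply: eq_forallb => i.
by rewrite mem_enum.
Qed.

Lemma box_uniq k : uniq (box n k).
Proof.
rewrite /box; have EP e : (e \in iota 0 k.+1) = (e <= k)%N by rewrite mem_iota.
move: (iota 0 k.+1) EP (iota_uniq 0 k.+1) => E EP uE.
(* The second conjunct makes the induction work: exponents not yet processed are 0, so the exponent
   added at [i] can be read off the result. *)
have aux s : uniq s -> let b := foldr (fun i s =>
    [seq (z.2 + U_(i) *+ z.1)%MM | z <- [seq (e, m) | e <- E, m <- s]])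
    [:: 0%MM : X] s in uniq b /\ forall m i, m \in b -> i \notin s -> m i = 0%N.
  elim: s => [_|i s IH /= /andP[is_ us]].
    by split=> // m i; rewrite inE => /eqP ->; rewrite mnm0E.
  have {IH}[ub hb] := IH us; set b := foldr _ _ _ in ub hb *.
  split; last first.
    move=> _ l /mapP[z /allpairsPdep[e [u [_ uin ->]]] ->] /=.
    rewrite inE negb_or => /andP[li ls].
    by rewrite mnmDE mulmnE mnm1E eq_sym (negPf li) mul0n (hb u).
  rewrite map_inj_in_uniq.
    by apply: allpairs_uniq => // -[? ?] [? ?] _ _.
  move=> _ _ /allpairsPdep[e [u [_ uin ->]]] /allpairsPdep[e' [u' [_ uin' ->]]] /= h.
  have ee : e = e'.
    move/mnmP/(_ i): h; rewrite !mnmDE !mulmnE mnm1E eqxx !mul1n.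
    by rewrite (hb u) // (hb u').
  by move: h; rewrite ee => /addIm ->.
exact: (aux _ (enum_uniq _)).1.
Qed.

Lemma mdeg_box k (m : X) : m \in box n k -> (mdeg m <= n * k)%N.
Proof.
rewrite mem_box => /forallP h; rewrite mdegE -[n in (n * _)%N]card_ord -sum_nat_const.
exact: leq_sum.
Qed.

Lemma box_mdeg k (m : X) : (mdeg m <= k)%N -> m \in box n k.
Proof.
move=> h; rewrite mem_box; apply/forallP => i; apply: leq_trans h.
by rewrite mdegE (bigD1 i) //= leq_addr.
Qed.

Lemma size_box k : size (box n k) = (k.+1 ^ n)%N.
Proof.
rewrite /box -[k.+1 in RHS](size_iota 0) -[n in RHS](size_enum_ord n).
move: (iota 0 k.+1) => E; elim: (enum _) => //= i s IH.
by rewrite size_map size_allpairs IH expnS.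
Qed.

End Box.

(** * Polynomial solutions with bounded exponents *)

Section Correctness.
Variables (n : nat) (K : fieldType) (r0 r1 : nat).
Local Notation X := 'X_{1..n}.
Local Notation A := {mpoly K[n]}.
Local Notation W := {mpoly {mpoly K[n]}[n]}.
Local Notation idx := (bool * (nat * (X * X)))%type.
Variables (L : 'M[weyl n K]_(r1, r0)) (S : nat * seq (seq (seq (K * (X * X))))).
Hypotheses (S1 : S.1 = r0) (S2 : size S.2 = r1).
Hypothesis SL : forall (i : 'I_r1) (j : 'I_r0), wsem (entry S i j) = L i j.

Lemma sum_iota (V : nmodType) k (F : nat -> V) :
  \sum_(i <- iota 0 k) F i = \sum_(i < k) F i.
Proof. by rewrite -(big_mkord predT) /index_iota subn0. Qed.

Lemma sum_delta (R : nzRingType) (T : eqType) (l : seq T) (F : T -> R) a :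
  uniq l -> \sum_(b <- l) F b * (b == a)%:R = if a \in l then F a else 0.
Proof.
move=> ul; case: ifP => [al|al].
  rewrite (bigD1_seq a) //= eqxx mulr1 big1 ?addr0 // => b /negPf ->.
  by rewrite mulr0.
rewrite big_seq big1 // => b bl; case: eqP => [e|_]; last by rewrite mulr0.
by rewrite -e bl in al.
Qed.

Lemma coef_tags (F : nat -> seq (K * (X * X))) k j a b :
  coef (flatten [seq tag i (F i) | i <- iota 0 k]) (true, (j, (a, b))) =
  if (j < k)%N then (wsem (F j))@_b@_a else 0.
Proof.
rewrite coef_flatten (eq_bigr (fun i => (wsem (F i))@_b@_a * (i == j)%:R)); last first.
  by move=> i _; rewrite coef_tag /=; case: eqP => [->|]; rewrite ?mulr1 ?mulr0.
by rewrite sum_delta ?iota_uniq // mem_iota.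
Qed.

Lemma coef_tags0 (F : nat -> seq (K * (X * X))) k z :
  coef (flatten [seq tag i (F i) | i <- iota 0 k]) (false, z) = 0.
Proof.
by case: z => j [a b]; rewrite coef_flatten big1 // => i _; rewrite coef_tag.
Qed.

Lemma coef_cons (I : eqType) (c : K) (i j : I) v :
  coef ((c, i) :: v) j = (i == j)%:R * c + coef v j.
Proof. by rewrite /=; case: eqP; rewrite ?mul1r // mul0r add0r. Qed.

Section Solve.
Variable N : nat.

Let start := [seq solgen S z.1 z.2 | z <- [seq (j, a) | j <- iota 0 S.1, a <- box n N]].

Definition fvec (x : idx -> K) : 'cV[A]_r0 :=
  \col_j \sum_(a <- box n N) x (false, (val j, (a, 0%MM))) *: 'X_[a].

Lemma fvec_coef x (j : 'I_r0) m :
  (fvec x j 0)@_m = if m \in box n N then x (false, (val j, (m, 0%MM))) else 0.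
Proof.
rewrite mxE raddf_sum /= -(sum_delta (fun a => x (false, (val j, (a, 0%MM))))) ?box_uniq //.
by apply: eq_bigr => a _; rewrite mcoeffZ mcoeffX.
Qed.

Lemma fvec_ext x y : x =1 y -> fvec x = fvec y.
Proof. by move=> e; apply/matrixP => j k; rewrite !mxE; apply: eq_bigr => a _; rewrite e. Qed.

Lemma fvecD x y c : fvec (fun i => x i + c * y i) = fvec x + c%:MP *: fvec y.
Proof.
apply/matrixP => j k; rewrite !ord1 [RHS]mxE [X in _ = _ + X]mxE.
apply/mpolyP => m; rewrite mul_mpolyC mcoeffD mcoeffZ !fvec_coef.
by case: ifP; rewrite // mulr0 addr0.
Qed.

Lemma fvec0 : fvec (fun=> 0) = 0.
Proof.
by apply/matrixP => j k; rewrite !ord1 !mxE big1 // => a _; rewrite scale0r.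
Qed.

Lemma fvec_sum k (c : nat -> K) (f : nat -> idx -> K) :
  fvec (fun i => \sum_(l < k) c l * f l i) = \sum_(l < k) (c l)%:MP *: fvec (f l).
Proof.
elim: k => [|k IH].
  by rewrite big_ord0 -fvec0; apply: fvec_ext => i; rewrite big_ord0.
rewrite big_ord_recr /= -IH -fvecD; apply: fvec_ext => i.
by rewrite big_ord_recr.
Qed.

Lemma solgen_false j a z :
  coef (solgen S j a) (false, z) = ((j, (a, 0%MM)) == z)%:R.
Proof.
by rewrite /solgen coef_cons coef_tags0 addr0 mulr1; case: z.
Qed.

Lemma solgen_true (j : 'I_r0) a k p q :
  coef (solgen S j a) (true, (k, (p, q))) =
  if insub k is Some i then
    if q == 0%MM then (weyl_act (L i j) 'X_[a])@_p else 0 else 0.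
Proof.
rewrite /solgen coef_cons mul0r add0r coef_tags S2.
case: insubP => [i -> ik|/negPf -> //]; rewrite -ik -SL -psem_wact wsem_coef.
rewrite /psem big_map; case: ifP => [/eqP ->|q0].
  rewrite raddf_sum /= big_mkcond big_seq [RHS]big_seq.
  apply: eq_bigr => t; rewrite mem_filter => /andP[/eqP t0 _].
  rewrite mcoeffZ mcoeffX; case: t t0 => c [u w] /= ->.
  by rewrite xpair_eqE eqxx andbT; case: (u == p); rewrite ?mulr1 ?mulr0.
rewrite big_seq_cond big1 // => t /andP[]; rewrite mem_filter => /andP[/eqP t0 _] /eqP e.
by move: q0; rewrite -t0 e eqxx.
Qed.

Lemma fvec_solgen (j j' : 'I_r0) a : a \in box n N ->
  fvec (coef (solgen S j a)) j' 0 = (j == j')%:R *: 'X_[a].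
Proof.
move=> aN; apply/mpolyP => m; rewrite fvec_coef solgen_false mcoeffZ mcoeffX.
rewrite !xpair_eqE eqxx andbT -(val_eqE j) -mulnb natrM.
case: ifP => // mN; have [am|_] := eqVneq a m; last by rewrite mulr0.
by rewrite -am aN in mN.
Qed.

Lemma startP v : v \in start ->
  exists (j : 'I_r0) a, a \in box n N /\ v = solgen S j a.
Proof.
case/mapP => z /allpairsPdep[j [a [jr aN ->]]] -> /=.
rewrite S1 mem_iota add0n in jr; by exists (Ordinal jr), a.
Qed.

(** This is the graph property of the generators. Both sides are linear in [x], which reduces it to
    one generator. The value is 0 when the row tag is out of range or a derivation is left, since
    [wact] keeps only terms free of derivations. *)
Lemma span_start_true x : lspan start x -> forall k p q,
  x (true, (k, (p, q))) = if insub k is Some i then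
    if q == 0%MM then (\sum_j weyl_act (L i j) (fvec x j 0))@_p else 0 else 0.
Proof.
move: x; apply: lspan_ind => [x y e h k p q|k p q|v c x vs IH k p q].
- rewrite -e h; case: insub => // i; case: ifP => // _.
  by congr (_@__); apply: eq_bigr => j _; rewrite (fvec_ext e).
- case: insub => // i; case: ifP => // _; rewrite big1 ?mcoeff0 // => j _.
  by rewrite fvec0 mxE weyl_act0r.
have [j [a [aN ->]]] := startP vs; rewrite IH solgen_true.
case: insub => [i|]; last by rewrite mulr0 addr0.
case: ifP => _; last by rewrite mulr0 addr0.
rewrite fvecD -mcoeffZ -mcoeffD; congr (_@__).
rewrite [RHS](eq_bigr (fun j' => weyl_act (L i j') (fvec x j' 0) +
  (j == j')%:R *: (c *: weyl_act (L i j') 'X_[a]))); last first.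
  move=> j' _.
  have -> : (fvec x + c%:MP *: fvec (coef (solgen S j a))) j' 0 =
      fvec x j' 0 + (j == j')%:R *: (c *: 'X_[a]).
    by rewrite mxE [X in _ + X]mxE fvec_solgen // mul_mpolyC !scalerA mulrC.
  by rewrite weyl_actDr !weyl_actZr.
rewrite big_split /= [X in _ = _ + X](bigD1 j) //= eqxx scale1r.
rewrite [X in _ = _ + (_ + X)]big1 ?addr0 // => j'.
by rewrite eq_sym => /negPf ->; rewrite scale0r.
Qed.

Lemma span_start_false x : lspan start x -> forall j a b,
  ~~ [&& (j < r0)%N, a \in box n N & b == 0%MM] -> x (false, (j, (a, b))) = 0.
Proof.
move: x; apply: lspan_ind => [x y e h j a b /h <- //|//|v c x vs IH j a b h].
have [j' [a' [aN ->]]] := startP vs; rewrite (IH _ _ _ h) solgen_false.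
have [e|_] := eqVneq (val j', (a', 0%MM)) (j, (a, b)); last by rewrite mulr0 addr0.
by case: e h => <- <- <-; rewrite ltn_ord aN eqxx.
Qed.

Lemma span_solveP x :
  lspan (solve S N) x <-> lspan start x /\ poly_solution L (fvec x).
Proof.
rewrite /solve lspan_restrict; split=> -[xs h]; split=> //.
  move=> i; apply/mpolyP => p; have := span_start_true xs i p 0%MM.
  by rewrite h // valK eqxx mcoeff0 => <-.
case=> -[] // [k [p q]] _; rewrite (span_start_true xs).
by case: insubP => // i _ _; rewrite h mcoeff0 if_same.
Qed.

Lemma solution_span (f : 'cV[A]_r0) : poly_solution L f ->
  (forall j m, m \in msupp (f j 0) -> m \in box n N) ->
  exists2 x, lspan (solve S N) x & fvec x = f.
Proof.
move=> fL fN; pose F (z : nat * X) := if insub z.1 is Some j then (f j 0)@_z.2 else 0.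
pose prs := [seq (j, a) | j <- iota 0 S.1, a <- box n N].
pose x i := \sum_(z <- prs) F z * coef (solgen S z.1 z.2) i.
have xs : lspan start x by apply: lspan_sum => z zp; apply/lspan_mem/map_f.
have xf : fvec x = f.
  apply/matrixP => j k; rewrite ord1; apply/mpolyP => m; rewrite fvec_coef.
  have -> : x (false, (val j, (m, 0%MM))) = if (val j, m) \in prs then F (val j, m) else 0.
    rewrite -sum_delta; last first.
      by apply: allpairs_uniq; rewrite ?iota_uniq ?box_uniq // => -[? ?] [? ?].
    apply: eq_bigr => z _; rewrite solgen_false; case: z => ? ?.
    by rewrite !xpair_eqE eqxx andbT.
  case: ifP => mN.
    rewrite /F /= valK ifT //; apply/allpairsP; exists (val j, m).
    by rewrite mem_iota S1 add0n ltn_ord.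
  by apply/esym/memN_msupp_eq0; apply: contraFN mN => /fN.
by exists x => //; apply/span_solveP; rewrite xf.
Qed.

(** Independence passes from lists to polynomial vectors because [fvec] is injective on the span of
    [solve S N]: image coordinates vanish there, and so do all unknowns that [fvec] does not
    read. *)
Lemma solve_basis :
  (forall f, poly_solution L f -> forall j m, m \in msupp (f j 0) -> m \in box n N) ->
  is_basis_mod (@mpolyC n K) (poly_solution L) (eq 0) [seq fvec (coef v) | v <- solve S N].
Proof.
move=> bound; set B := [seq _ | v <- _].
have sB : size B = size (solve S N) by rewrite size_map.
have nthB k : (k < size (solve S N))%N -> B`_k = fvec (coef (nth [::] (solve S N) k)).
  by move=> lt_k; rewrite (nth_map [::]).
split.
- by move=> v /mapP[w /lspan_mem/span_solveP[_ h] ->].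
- move=> c /esym c0 i.
  pose c' k := if insub k is Some l then c l else 0.
  pose x z := \sum_(k < size (solve S N)) c' k * coef (nth [::] (solve S N) k) z.
  have xs : lspan (solve S N) x by apply/lspanP; exists c'.
  have x0 : fvec x = 0.
    rewrite (fvec_sum _ c' (fun k => coef (nth [::] (solve S N) k))) -[RHS]c0 -sB.
    apply: eq_bigr => k _.
    by rewrite /c' valK nthB // -sB.
  have /span_solveP[xs' _] := xs.
  have xE z : x z = 0.
    case: z => -[[j [a b]]|[j [a b]]].
      have := xs; rewrite /solve lspan_restrict => -[_]; exact.
    have [/and3P[jr aN /eqP ->]|/(span_start_false xs') //] :=
      boolP [&& (j < r0)%N, a \in box n N & b == 0%MM].
    by have := fvec_coef x (Ordinal jr) a; rewrite aN x0 mxE mcoeff0.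
  have lF : lfree (solve S N).
    apply: lfree_restrict; apply: (lfree_delta (h := fun z => (false, (z.1, (z.2, 0%MM))))).
      by apply: allpairs_uniq; rewrite ?iota_uniq ?box_uniq // => -[? ?] [? ?].
    move=> [j a] [j' a']; rewrite [LHS]solgen_false; symmetry.
    by rewrite !xpair_eqE eqxx andbT.
  have := lfreeP lF xE (k := val i); rewrite -sB ltn_ord => /(_ isT).
  by rewrite /c' valK.
move=> f fL; have [x /lspanP[c xc] <-] := solution_span fL (bound f fL).
exists (fun i => c (val i)); apply/esym/eqP; rewrite subr_eq0; apply/eqP.
rewrite (fvec_ext xc) (fvec_sum _ c (fun k => coef (nth [::] (solve S N) k))) -sB.
apply: eq_bigr => k _.
by rewrite nthB // -sB.
Qed.

Lemma rep_output (repK : Rep K) t : rep t (output S N) ->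
  rep_vectors repK t [seq fvec (coef v) | v <- solve S N].
Proof.
rewrite /rep_vectors /output S1.
have : {in solve S N, forall v, lspan start (coef v)}.
  by move=> v /lspan_mem/span_solveP[].
elim: (solve S N) t => [|v s IH] [|t1 t2] //= h [h1 h2]; split; last first.
  by apply: IH => // w ws; apply: h; rewrite inE ws orbT.
have {h} vs := h v (mem_head _ _); move: h1; rewrite /rep_mx /=.
rewrite -[iota 0 r0](val_enum_ord) -map_comp.
elim: (enum 'I_r0) t1 => [|j l IHl] [|u1 u2] //= [h1 h3]; split; last exact: IHl.
rewrite enum_ordSl enum_ord0; case: u1 h1 => // u1 u3 [h1 h4]; split; last by case: u3 h4.
exists (unknown (val j) v) => //; apply/mpolyP => m.
rewrite fvec_coef /unknown big_map big_filter raddf_sum /=.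
have -> : (if m \in box n N then coef v (false, (val j, (m, 0%MM))) else 0) =
    coef v (false, (val j, (m, 0%MM))).
  by case: ifP => // mN; rewrite (span_start_false vs) // mN andbF.
rewrite coefE [RHS]big_mkcond [LHS]big_mkcond /=; apply: eq_bigr => -[c [k [j' [a b]]]] _ /=.
rewrite mcoeffZ mcoeffX !xpair_eqE eqxx /=.
by case: (a == m); rewrite ?mulr1 ?mulr0 ?andbF ?if_same.
Qed.

End Solve.

(** * Degree certificates *)

Section Certificates.
Variable k : nat.

Let T (a : X) (b : nat) := wx a (iter b (@wtheta n K) [:: (1, (0%MM, 0%MM))]).

Let start (j : nat) :=
  [seq certQ S z.1 z.2.1 z.2.2 | z <- [seq (i, w) | i <- iota 0 (size S.2),
        w <- [seq (a, b) | a <- box n k, b <- box n k]]] ++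
  [seq certC K j z.1 z.2 | z <- [seq (a, b) | a <- box n k, b <- iota 0 k.+1]].

Definition certop (x : idx -> K) : W :=
  \sum_(z <- [seq (a, b) | a <- box n k, b <- iota 0 k.+1])
     (x (false, (z.2, (z.1, 0%MM))))%:MP *: wsem (T z.1 z.2).

Lemma certop_ext x y : x =1 y -> certop x = certop y.
Proof. by move=> e; apply: eq_bigr => z _; rewrite e. Qed.

Lemma certopD x y c : certop (fun i => x i + c * y i) = certop x + c%:MP *: certop y.
Proof.
rewrite /certop scaler_sumr -big_split; apply: eq_bigr => z _ /=.
by rewrite scalerA -mpolyCM -scalerDl -mpolyCD.
Qed.

Lemma certop0 : certop (fun=> 0) = 0.
Proof. by rewrite /certop big1 // => z _; rewrite mpolyC0 scale0r. Qed.

Lemma certC_false j (a : X) b z : coef (certC K j a b) (false, z) = ((b, (a, 0%MM)) == z)%:R.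
Proof. by rewrite /certC coef_cons; case: z => ? [? ?]; rewrite coef_tag addr0 mulr1. Qed.

Lemma certC_true j (a : X) b j' p q :
  coef (certC K j a b) (true, (j', (p, q))) = if j == j' then (wsem (T a b))@_q@_p else 0.
Proof. by rewrite /certC coef_cons coef_tag mul0r add0r. Qed.

Lemma certQ_false i a b z : coef (certQ S i a b) (false, z) = 0.
Proof. exact: coef_tags0. Qed.

Lemma certQ_true (i : 'I_r1) a b (j : 'I_r0) p q :
  coef (certQ S i a b) (true, (val j, (p, q))) =
  (weyl_mul (weyl_monom K a b) (L i j))@_q@_p.
Proof. by rewrite /certQ coef_tags S1 ltn_ord wsem_wmon SL. Qed.

Lemma certop_certC j (a : X) b : a \in box n k -> (b <= k)%N ->
  certop (coef (certC K j a b)) = wsem (T a b).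
Proof.
move=> ak bk; have ab : (a, b) \in [seq (a, b) | a <- box n k, b <- iota 0 k.+1].
  by apply/allpairsPdep; exists a, b; rewrite mem_iota.
have un : uniq [seq (a, b) | a <- box n k, b <- iota 0 k.+1].
  by apply: allpairs_uniq; rewrite ?iota_uniq ?box_uniq // => -[? ?] [? ?].
rewrite /certop (bigD1_seq (a, b) ab un) certC_false eqxx mpolyC1 scale1r.
rewrite big1; [exact: addr0|case=> a' b'].
rewrite certC_false !xpair_eqE eqxx andbT andbC [a == _]eq_sym [b == _]eq_sym => /negPf ->.
by rewrite mpolyC0 scale0r.
Qed.

Lemma certop_certQ i a b : certop (coef (certQ S i a b)) = 0.
Proof. by rewrite /certop big1 // => z _; rewrite certQ_false mpolyC0 scale0r. Qed.

Lemma weyl_coefD (u v : weyl n K) p q :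
  (u + v : weyl n K)@_q@_p = (u : W)@_q@_p + (v : W)@_q@_p.
Proof. by rewrite -!mcoeffD. Qed.

(** The multiplier Q is rebuilt along the linear combination, each [certQ] generator adding a scaled
    monomial to one entry of it. *)
Lemma span_cert_start (j : nat) x : lspan (start j) x ->
  exists Q : 'rV[weyl n K]_r1, forall (j' : 'I_r0) p q,
    x (true, (val j', (p, q))) = ((Q *m L) 0 j' : W)@_q@_p +
      (if j == val j' then (certop x)@_q@_p else 0).
Proof.
move: x; apply: lspan_ind => [x y e [Q h]||v c x + [Q IH]].
- by exists Q => j' p q; rewrite -e h (certop_ext e).
- exists 0 => j' p q; rewrite mul0mx mxE certop0 !mcoeff0 if_same.
  by rewrite addr0.
rewrite mem_cat => /orP[] /mapP[z].
  case/allpairsPdep=> i [w [ir1 /allpairsPdep[a [b [_ _ ->]]] ->]] ve.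
  have {ve} -> : v = certQ S i a b by [].
  rewrite S2 mem_iota add0n in ir1.
  pose u : 'rV[weyl n K]_r1 := \row_l
    (if l == Ordinal ir1 then weylC n c * weyl_monom K a b else 0).
  have uE j' : (u *m L) 0 j' = c%:MP *: (weyl_mul (weyl_monom K a b) (L (Ordinal ir1) j') : W).
    rewrite mxE (bigD1 (Ordinal ir1)) //= mxE eqxx big1 ?addr0.
      by rewrite -mulrA weylCE.
    by move=> l /negPf h; rewrite mxE h mul0r.
  exists (Q + u) => j' p q.
  have -> : ((Q + u) *m L) 0 j' = (Q *m L) 0 j' + (u *m L) 0 j' by rewrite mulmxDl mxE.
  rewrite IH uE certopD certop_certQ.
  rewrite scaler0 addr0 (certQ_true (Ordinal ir1)).
  rewrite weyl_coefD mcoeffZ mul_mpolyC mcoeffZ.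
  by rewrite addrAC.
case/allpairsPdep=> a [b [ak + ->]] ve; have {ve} -> : v = certC K j a b by [].
rewrite mem_iota ltnS => bk.
exists Q => j' p q; rewrite IH certopD certop_certC // certC_true -addrA; congr (_ + _).
case: (j == _); last by rewrite mulr0 addr0.
by rewrite mcoeffD mcoeffZ mcoeffD mul_mpolyC mcoeffZ.
Qed.

Lemma solution_mul (Q : 'rV[weyl n K]_r1) (f : 'cV[A]_r0) : poly_solution L f ->
  \sum_j weyl_act ((Q *m L) 0 j) (f j 0) = 0.
Proof.
move=> fL; rewrite (eq_bigr (fun j => \sum_i weyl_act (Q 0 i) (weyl_act (L i j) (f j 0)))).
  rewrite exchange_big big1 //= => i _.
  by rewrite -weyl_act_sumr fL weyl_act0r.
move=> j _; rewrite mxE weyl_act_suml; apply: eq_bigr => i _.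
by rewrite weyl_actM.
Qed.

(** A zero image means that Q L is minus the operator in position [j] and 0 elsewhere, and Q L
    annihilates every solution. *)
Lemma cert_annihilates (j : 'I_r0) x f : lspan (cert S j k) x -> poly_solution L f ->
  weyl_act (certop x) (f j 0) = 0.
Proof.
rewrite /cert lspan_restrict => -[/span_cert_start[Q h] x0] fL.
have QE (j' : 'I_r0) : (Q *m L) 0 j' = if j == j' then - certop x else 0.
  apply/mpolyP => q; apply/mpolyP => p; have := h j' p q.
  rewrite x0 // => /esym/eqP; rewrite addr_eq0 => /eqP ->.
  by rewrite val_eqE; case: ifP; rewrite ?mcoeffN ?mcoeff0 ?oppr0.
have := solution_mul Q fL; rewrite (bigD1 j) //= big1 ?addr0 => [|j' /negPf jj'].
  rewrite QE eqxx -scaleN1r weyl_actZ => /eqP.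
  by rewrite mulN1r oppr_eq0 => /eqP.
by rewrite QE eq_sym jj' weyl_act0l.
Qed.

Lemma max_mnm (s : seq X) : s != [::] ->
  exists2 a, a \in s & forall b, b \in s -> (b <= a)%O.
Proof.
elim: s => // a [|b s] IH _.
  by exists a; rewrite ?mem_head // => b; rewrite inE => /eqP ->.
have [//|c cs ch] := IH.
have [ac|ca] := Order.TotalTheory.leP a c.
  exists c; first by rewrite inE cs orbT.
  by move=> d; rewrite inE => /orP[/eqP -> //|/ch].
exists a; first exact: mem_head.
move=> d; rewrite inE => /orP[/eqP -> //|/ch dc].
by apply: Order.PreorderTheory.le_trans dc _; exact: Order.PreorderTheory.ltW.
Qed.

(* With a0 the largest a such that c_a is nonzero and m0 the leading monomial of
   f_j, the coefficient of x^(a0 + m0) in (\sum_ab c_ab x^a Theta^b) f_j is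
   c_a0(deg m0) times the leading coefficient of f_j. *)
Lemma check_sound N (j : 'I_r0) v f : v \in cert S j k -> check N k v ->
  poly_solution L f -> forall m, m \in msupp (f j 0) -> (mdeg m < N)%N.
Proof.
move=> /lspan_mem vs /andP[v1 v2] fL m; move: (cert_annihilates vs fL).
move: (f j 0) => g g0 mg.
have gn0 : g != 0 by apply: contraTneq mg => ->; rewrite msupp0.
(* The monomial order refines the total degree, so only the leading monomial has to be bounded. *)
apply: leq_ltn_trans (lemc_mdeg (msupp_le_mlead mg)) _.
pose c a := Poly (colpoly k v a).
pose h a := \sum_(b <- iota 0 k.+1) coef v (false, (b, (a, 0%MM))) *: iter b (@euler n K) g.
have hE a l : (h a)@_l = (c a).[(mdeg l)%:R] * g@_l.
  rewrite /h sum_iota raddf_sum -sum_Poly mulr_suml size_map size_iota.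
  apply: eq_bigr => b _; rewrite [LHS]mcoeffZ iter_euler_coef mulrA.
  by rewrite (nth_map 0%N) ?size_iota // nth_iota.
have sum0 : \sum_(a <- box n k) 'X_[a] * h a = 0.
  rewrite -[RHS]g0 /certop [RHS]weyl_act_suml big_allpairs_dep.
  apply: eq_bigr => a _; rewrite mulr_sumr; apply: eq_bigr => b _.
  by rewrite weyl_actZ weyl_act_cert -scalerAr mul_mpolyC.
pose A0 := [seq a <- box n k | c a != 0].
have [|a0 + a0max] := @max_mnm A0.
  case/hasP: v1 => a ak /hasP[d dc d0].
  suff : a \in A0 by case: A0.
  by rewrite mem_filter ak andbT Poly_eq0 -has_predC; apply/hasP; exists d.
rewrite mem_filter => /andP[c0 a0k].
(* Theta acts diagonally on monomials, so c_a(Theta) g has no monomial outside the support of g. It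
   may lose the leading one, hence an inequality. *)
have h_lead a : (mlead (h a) <= mlead g)%O.
  have [->|/mlead_supp] := eqVneq (h a) 0; first by rewrite mlead0 le0m.
  rewrite mcoeff_msupp hE mulf_eq0 negb_or -mcoeff_msupp => /andP[_].
  exact: msupp_le_mlead.
have /eqP := congr1 (mcoeff (a0 + mlead g)) sum0.
rewrite raddf_sum /= mcoeff0 (bigD1_seq a0) ?box_uniq //= big1_seq ?addr0; last first.
  move=> a /andP[aa0 ak]; have [ca|ca] := eqVneq (c a) 0.
    suff -> : h a = 0 by rewrite mulr0 mcoeff0.
    by apply/mpolyP => l; rewrite hE ca horner0 mul0r mcoeff0.
  rewrite mleadcMW ?h_lead // ?mleadXm ?a0max ?mem_filter ?ca //.
  by rewrite mcoeffX (negPf aa0) mul0r.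
rewrite mleadcMW ?mleadXm // mcoeffX eqxx mul1r hE mulf_eq0.
rewrite (negPf (_ : g@_(mlead g) != 0)) ?orbF -?mcoeff_msupp ?mlead_supp // => root0.
have /allP/(_ _ a0k) := v2; rewrite -Poly_eq0 (negPf c0) /= => /noroot_shiftP hN.
by rewrite ltnNge; apply/negP => /hN; rewrite root0.
Qed.

End Certificates.

Lemma bounded_sound N f : bounded S N -> poly_solution L f ->
  forall j m, m \in msupp (f j 0) -> m \in box n N.
Proof.
move=> /allP bN fL j m mf; apply: box_mdeg; apply: ltnW.
have /bN/hasP[k _ /hasP[v vc ck]] : val j \in iota 0 S.1 by rewrite mem_iota S1 add0n ltn_ord.
exact: check_sound vc ck fL m mf.
Qed.

(** * Existence of certificates for holonomic systems *)

Let T (a : X) (b : nat) := wx a (iter b (@wtheta n K) [:: (1, (0%MM, 0%MM))]).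
Let prs (k : nat) := [seq (a, b) | a <- box n k, b <- iota 0 k.+1].

Lemma prs_uniq k : uniq (prs k).
Proof. by apply: allpairs_uniq; rewrite ?iota_uniq ?box_uniq // => -[? ?] [? ?]. Qed.

Lemma mem_prs k a b : ((a, b) \in prs k) = (a \in box n k) && (b <= k)%N.
Proof.
by apply/allpairsPdep/andP => [[a' [b' [ha hb [-> ->]]]]|[ha hb]];
  [rewrite mem_iota in hb|exists a, b; rewrite mem_iota].
Qed.

Lemma weylCM (c d : K) : weylC n (c * d) = weylC n c * weylC n d.
Proof. by rewrite weylCE /weylC -mul_mpolyC -!mpolyCM. Qed.

Lemma weylCD (c d : K) : weylC n (c + d) = weylC n c + weylC n d.
Proof. by rewrite /weylC !mpolyCD. Qed.

Lemma weylC_sum (I : finType) (F : I -> K) : weylC n (\sum_i F i) = \sum_i weylC n (F i).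
Proof.
have w0 : weylC n 0 = 0 :> weyl n K by rewrite /weylC !mpolyC0.
exact: (big_morph _ weylCD w0).
Qed.

(** Modulo D L the operators in position [j] are combinations of [B]. There are more operators than
    elements of [B], so the matrix of coordinates has a nonzero row [u] in its left kernel, and the
    same combination of the multipliers [R t] is Q. *)
Lemma dependent_operators (j : 'I_r0) k (B : seq 'rV[weyl n K]_r0) :
  (forall v, bernstein (n * k + k.*2) v -> exists c : 'I_(size B) -> K,
     row_submodule L (v - \sum_i weylC n (c i) *: B`_i)) ->
  (size B < k.+1 ^ n * k.+1)%N ->
  exists c : X * nat -> K, (exists2 z, z \in prs k & c z != 0) /\
    exists Q : 'rV[weyl n K]_r1, forall j', (Q *m L) 0 j' =
      if j == j' then \sum_(z <- prs k) (c z)%:MP *: wsem (T z.1 z.2) else 0 :> W.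
Proof.
move=> hB szB; set m := size (prs k).
have mE : m = (k.+1 ^ n * k.+1)%N by rewrite /m size_allpairs size_box size_iota.
pose z0 : X * nat := (0%MM, 0%N).
pose op (t : 'I_m) : W := wsem (T (nth z0 (prs k) t).1 (nth z0 (prs k) t).2).
pose v (t : 'I_m) : 'rV[weyl n K]_r0 := \row_j' (if j == j' then op t else 0).
have vF t : bernstein (n * k + k.*2) (v t).
  move=> j' a b; rewrite mxE; case: ifP => _; last by rewrite !mcoeff0 eqxx.
  move=> /(wsem_tdeg (tdeg_cert _ _ _)) /leq_trans; apply.
  have : nth z0 (prs k) t \in prs k by exact: mem_nth.
  case: (nth _ _ _) => a' b'; rewrite mem_prs => /andP[/mdeg_box ha hb] /=.
  by rewrite leq_add // leq_double.
have [C hC] := choice (fun t => hB _ (vF t)).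
have [R hR] := choice hC.
pose M : 'M[K]_(m, size B) := \matrix_(t, i) C t i.
have /rowV0Pn[u /sub_kermxP uM u0] : kermx M != 0.
  rewrite -mxrank_eq0 mxrank_ker subn_eq0 -ltnNge.
  by apply: leq_ltn_trans (rank_leq_col M) _; rewrite mE.
have umE : \sum_t weylC n (u 0 t) *: v t = (\sum_t weylC n (u 0 t) *: R t) *m L.
  rewrite mulmx_suml.
  under [RHS]eq_bigr => t _ do rewrite -scalemxAl -hR scalerBr scaler_sumr.
  rewrite sumrB exchange_big /= [X in _ - X]big1 ?subr0 // => i _.
  under eq_bigr => t _ do rewrite scalerA -weylCM.
  rewrite -scaler_suml -weylC_sum.
  have := congr1 (fun N : 'rV_ _ => N 0 i) uM; rewrite !mxE => uMi.
  under eq_bigr => t _ do rewrite -[C t i](mxE matrix_key (fun t i => C t i)).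
  by rewrite uMi /weylC !mpolyC0 scale0r.
pose c z := if insub (index z (prs k)) is Some t then u 0 t else 0.
have cE (t : 'I_m) : c (nth z0 (prs k) t) = u 0 t.
  by rewrite /c index_uniq ?prs_uniq // valK.
exists c; split.
  have [t ut] : exists t, u 0 t != 0.
    apply/existsP; rewrite -negb_forall; apply: contra u0 => /forallP h.
    by apply/eqP/rowP => t; rewrite mxE; apply/eqP.
  by exists (nth z0 (prs k) t); rewrite ?cE // mem_nth.
exists (\sum_t weylC n (u 0 t) *: R t) => j'; rewrite -umE summxE.
rewrite (big_nth z0) big_mkord; case: ifP => jj'; last first.
  by rewrite big1 // => t _; rewrite !mxE jj' mulr0.
apply: eq_bigr => t _; rewrite !mxE jj' cE.
exact: weylCE.
Qed.

Lemma chi_growth (chi : {poly rat}) k0 : size chi = n.+1 ->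
  exists k, (k0 <= n * k + k.*2)%N /\
    (chi.[(n * k + k.*2)%:R] < (k.+1 ^ n * k.+1)%:R)%R.
Proof.
move=> schi; pose C := \sum_(i < size chi) `|chi`_i|.
(* With x = (n + 2) k at least 1, chi(x) is at most C x^n, hence at most M (n + 2)^n k^n. The choice
   of [k] makes this at most k^(n + 1); the successor ensures that x is positive. *)
pose M := Num.bound C; pose k := (maxn k0 (M * (n + 2) ^ n)).+1.
have CM : C <= M%:R by apply: ltW; exact: archi_boundP (sumr_ge0 _ (fun _ _ => normr_ge0 _)).
exists k; split.
  have : (k0 <= k)%N by rewrite leqW // leq_maxl.
  by move=> h; apply: leq_trans h _; rewrite -addnn addnA leq_addl.
have xE : (n * k + k.*2 = (n + 2) * k)%N by rewrite -muln2 mulnDl [(2 * k)%N]mulnC.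
rewrite xE; set x := ((n + 2) * k)%N.
have x1 : 1 <= x%:R :> rat by rewrite (ler_nat _ 1) muln_gt0 addn2.
apply: (@le_lt_trans _ _ (C * x%:R ^+ n)).
  rewrite horner_coef; apply: le_trans (ler_norm _) _.
  apply: le_trans (ler_norm_sum _ _ _) _; rewrite /C mulr_suml; apply: ler_sum => i _.
  rewrite normrM; apply: ler_wpM2l => //; rewrite normrX ger0_norm //.
  by apply: ler_weXn2l => //; rewrite -ltnS -schi.
apply: (@le_lt_trans _ _ (M%:R * x%:R ^+ n)).
  by apply: ler_wpM2r => //; rewrite exprn_ge0.
rewrite -natrX -natrM ltr_nat /x expnMn mulnA.
apply: (@leq_ltn_trans (k * k ^ n)%N).
  by rewrite leq_mul2r leqW ?orbT // leq_maxr.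
rewrite [(_ * k.+1)%N]mulnC -!expnS ltn_exp2r //.
Qed.

Lemma holonomic_dependent (j : 'I_r0) : holonomic (row_submodule L) ->
  exists k (c : X * nat -> K), (exists2 z, z \in prs k & c z != 0) /\
    exists Q : 'rV[weyl n K]_r1, forall j', (Q *m L) 0 j' =
      if j == j' then \sum_(z <- prs k) (c z)%:MP *: wsem (T z.1 z.2) else 0 :> W.
Proof.
case=> [h|[chi [k0 [schi h]]]].
  (* For the zero module, level 0 suffices: its only operator is 1, and the empty list spans the
     quotient. *)
  exists 0%N; apply: (@dependent_operators j 0%N [::]) => [v _|].
    by exists (fun=> 0).
  by rewrite exp1n.
have [k [lek ltk]] := chi_growth k0 schi.
have [B [[_ _ hB] sB]] := h _ lek.
exists k; apply: (@dependent_operators j k B) => //.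
by rewrite -(ltr_nat rat) -sB.
Qed.

(** Finitely many thresholds are replaced by their maximum; this is applied to the columns of a
    certificate and then to the positions [j]. *)
Lemma eventually_all (U : eqType) (s : seq U) (P : U -> nat -> Prop) :
  (forall a, a \in s -> exists N, forall N', (N <= N')%N -> P a N') ->
  exists N, forall N', (N <= N')%N -> forall a, a \in s -> P a N'.
Proof.
elim: s => [|a s IH] h; first by exists 0%N.
have [N1 h1] := h a (mem_head _ _).
have [N2 h2] := IH (fun b bs => h b (mem_behead (s := a :: s) bs)).
exists (maxn N1 N2) => N'; rewrite geq_max => /andP[/h1 ha /h2 hs] b.
by rewrite inE => /orP[/eqP ->|/hs].
Qed.

Lemma weyl_support (q : W) : exists k, forall a b,
  q@_b@_a != 0 -> (a \in box n k) && (b \in box n k).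
Proof.
exists (msize q + \sum_(b <- msupp q) msize q@_b)%N => a b ab.
have bq : b \in msupp q by rewrite mcoeff_msupp; apply: contraNneq ab => ->; rewrite mcoeff0.
have aq : a \in msupp q@_b by rewrite mcoeff_msupp.
apply/andP; split; apply: box_mdeg; apply: ltnW.
  apply: leq_trans (msize_mdeg_lt aq) _.
  by rewrite (bigD1_seq b) ?msupp_uniq //= addnCA leq_addr.
by apply: leq_trans (msize_mdeg_lt bq) _; exact: leq_addr.
Qed.

Hypothesis char0 : forall k : nat, k%:R = 0 :> K -> k = 0%N.

Lemma mcoeff_sum2 (U : Type) (s : seq U) (F : U -> W) q p :
  (\sum_(z <- s) F z)@_q@_p = \sum_(z <- s) (F z)@_q@_p.
Proof. by rewrite raddf_sum /= raddf_sum. Qed.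

Lemma box_leq k l (a : X) : (k <= l)%N -> a \in box n k -> a \in box n l.
Proof.
move=> kl; rewrite !mem_box => /forallP h.
by apply/forallP => i; apply: leq_trans (h i) kl.
Qed.

Lemma sum_prs_widen (V : nmodType) k l (F : X * nat -> V) : (k <= l)%N ->
  \sum_(z <- prs l) (if z \in prs k then F z else 0) = \sum_(z <- prs k) F z.
Proof.
move=> kl; rewrite -big_mkcond -big_filter; apply: perm_big.
apply: uniq_perm; rewrite ?filter_uniq ?prs_uniq // => -[a b].
rewrite mem_filter; apply: andb_idr; rewrite !mem_prs => /andP[ak bk].
by rewrite (leq_trans bk kl) (box_leq kl ak).
Qed.

Lemma weyl_expand k (p : weyl n K) (q : weyl n K) :
  (forall a b, (p : W)@_b@_a != 0 -> (a \in box n k) && (b \in box n k)) ->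
  p * q = \sum_(w <- [seq (a, b) | a <- box n k, b <- box n k])
     (((p : W)@_w.2@_w.1)%:MP *: (weyl_mul (weyl_monom K w.1 w.2) q : W)) :> weyl n K.
Proof.
move=> pk.
have pE : p = \sum_(w <- [seq (a, b) | a <- box n k, b <- box n k])
    (((p : W)@_w.2@_w.1)%:MP *: (weyl_monom K w.1 w.2 : W)) :> W.
  apply/mpolyP => b; apply/mpolyP => a.
  have un : uniq [seq (a, b) | a <- box n k, b <- box n k].
    by apply: allpairs_uniq; rewrite ?box_uniq // => -[? ?] [? ?].
  rewrite mcoeff_sum2.
  rewrite (eq_bigr (fun w => (p : W)@_w.2@_w.1 * (w == (a, b))%:R)); last first.
    move=> [a' b'] _ /=; rewrite mcoeffZ weyl_monomE mcoeffZ mcoeffX mulrA.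
    rewrite xpair_eqE; case: (b' == b); last by rewrite mulr0 mcoeff0 andbF mulr0.
    by rewrite mulr1 mul_mpolyC mcoeffZ mcoeffX andbT.
  rewrite sum_delta //; case: ifP => // /negbT ab.
  apply/eqP; apply: contraR ab => /pk /andP[ha hb].
  by apply/allpairsPdep; exists a, b.
rewrite [in LHS]pE [LHS]mulr_suml; apply: eq_bigr => w _.
by rewrite -[X in X * q]weylCE -mulrA weylCE.
Qed.

Lemma bounded_complete : holonomic (row_submodule L) -> exists N, bounded S N.
Proof.
move=> hol.
have step (j : nat) : j \in iota 0 S.1 -> exists N, forall N', (N <= N')%N ->
    has (fun k => has (check N' k) (cert S j k)) (iota 0 N').
  rewrite S1 mem_iota add0n => /andP[_ jr]; pose j0 := Ordinal jr.
  have [k0 [c [[[a0 b0] z0 cz0] [Q hQ]]]] := holonomic_dependent j0 hol.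
  have [k1 hk1] : exists k1, forall i a b, ((Q 0 i : W)@_b@_a != 0) ->
      (a \in box n k1) && (b \in box n k1).
    have [f hf] := choice (fun i => weyl_support (Q 0 i)).
    exists (\sum_i f i)%N => i a b /hf /andP[ha hb].
    have fi : (f i <= \sum_i f i)%N by rewrite (bigD1 i) //= leq_addr.
    by rewrite !(box_leq fi).
  (* One level has to accommodate both the operator, found at [k0], and the monomials of Q, bounded
     by [k1]. The coefficients are padded with zeros. *)
  pose k := maxn k0 k1; have k0k : (k0 <= k)%N := leq_maxl _ _.
  have hQk i a b : (Q 0 i : W)@_b@_a != 0 -> (a \in box n k) && (b \in box n k).
    by move=> /hk1/andP[ha hb]; rewrite !(box_leq (leq_maxr k0 k1)).
  pose c' z := if z \in prs k0 then c z else 0.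
  pose ab := [seq (a, b) | a <- box n k, b <- box n k].
  pose ws := [seq (i, w) | i <- iota 0 (size S.2), w <- ab].
  pose F (u : nat * (X * X)) :=
    if insub u.1 is Some i then (Q 0 i : W)@_u.2.2@_u.2.1 else 0.
  (* [y] carries the operator and [q] the multiplier. Their images agree by the relation [hQ], so
     the difference lies in the kernel computed by [cert]. *)
  pose y z := \sum_(w <- prs k) c' w * coef (certC K j w.1 w.2) z.
  pose q z := \sum_(u <- ws) F u * coef (certQ S u.1 u.2.1 u.2.2) z.
  have xs : lspan (cert S j k) (fun z => y z - q z).
    rewrite /cert lspan_restrict; split.
      apply: lspanB; apply: lspan_sum => w ww; apply: lspan_mem;
        rewrite mem_cat; apply/orP; [right|left]; by apply/mapP; exists w.
    case=> -[] // [j' [p r]] _; apply/eqP; rewrite subr_eq0; apply/eqP.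
    rewrite /y /q; have [lt_j'|le_j'] := ltnP j' r0; last first.
      rewrite [LHS]big1 => [|w _].
        by rewrite big1 // => w _; rewrite /certQ coef_tags S1 ltnNge le_j' mulr0.
      rewrite certC_true; case: eqP => [e|]; last by rewrite mulr0.
      by rewrite -e leqNgt jr in le_j'.
    pose j1 := Ordinal lt_j'.
    transitivity (((Q *m L) 0 j1 : W)@_r@_p).
      have e01 : (j0 == j1) = (j == j') by [].
      rewrite hQ e01; case: ifP => [/eqP ejj|njj]; last first.
        rewrite mcoeff0 mcoeff0 big1 // => w _.
        by rewrite certC_true njj mulr0.
      rewrite -(sum_prs_widen _ k0k) mcoeff_sum2; apply: eq_bigr => w _.
      rewrite certC_true ejj eqxx /c'; case: ifP => _; last by rewrite mul0r !mcoeff0.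
      by rewrite mcoeffZ mul_mpolyC mcoeffZ.
    rewrite mxE (eq_bigr _ (fun i _ => weyl_expand (L i j1) (hQk i))).
    rewrite /ws big_allpairs_dep S2 sum_iota.
    have wsum (I : finType) (G : I -> weyl n K) :
        ((\sum_i G i : weyl n K) : W)@_r@_p = \sum_i (G i : W)@_r@_p.
      exact: (mcoeff_sum2 _ (fun i => G i : W)).
    rewrite wsum; apply: eq_bigr => i _.
    rewrite [LHS]mcoeff_sum2; apply: eq_bigr => w _.
    by rewrite (certQ_true i _ _ j1) /F /= valK mcoeffZ mul_mpolyC mcoeffZ.
  have x0 : y (false, (b0, (a0, 0%MM))) - q (false, (b0, (a0, 0%MM))) != 0.
    rewrite /q [X in _ - X]big1 => [|u _]; last by rewrite certQ_false mulr0.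
    rewrite subr0 /y (eq_bigr (fun w => c' w * (w == (a0, b0))%:R)).
      rewrite sum_delta ?prs_uniq // /c' z0 ifT //.
      by move: z0; rewrite !mem_prs => /andP[/(box_leq k0k) -> bk]; exact: leq_trans k0k.
    by move=> [a b] _; rewrite certC_false !xpair_eqE eqxx andbT andbC.
  (* The test inspects only the listed generators. If all of them had coordinate 0 at (a0, b0), so
     would every vector of the span, contrary to [x0]. *)
  have [v vc v0] : exists2 v, v \in cert S j k & coef v (false, (b0, (a0, 0%MM))) != 0.
    apply: contrapT => h; move/eqP: x0; apply.
    apply: (_ : forall x, lspan (cert S j k) x -> x (false, (b0, (a0, 0%MM))) = 0) xs.
    apply: lspan_ind => [x x' <- //|//|v d x vc ->].
    rewrite add0r; apply/eqP; rewrite mulf_eq0; apply/orP; right.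
    by apply: contraPT h => hv; apply; exists v.
  have [a0k b0k] : a0 \in box n k /\ (b0 <= k)%N.
    by move: z0; rewrite mem_prs => /andP[/(box_leq k0k) -> /leq_trans ->].
  have ev a : a \in box n k -> exists N, forall N', (N <= N')%N ->
      all (fun c => c == 0) (colpoly k v a) ||
      noroot (iter N' (@shift1 K) (colpoly k v a)).
    move=> ak; have [pa|pa] := boolP (all (fun c => c == 0) (colpoly k v a)).
      by exists 0%N.
    have [|N hN] := natural_roots_bounded char0 (p := Poly (colpoly k v a)).
      by rewrite Poly_eq0.
    exists N => N' NN' /=; apply/noroot_shiftP => l lN'.
    by apply: hN; apply: leq_trans lN'.
  have [N hN] := eventually_all ev.
  (* [N] takes care of the natural roots, and [k.+1] brings the level [k] into the range that is
     searched. *)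
  exists (maxn N k.+1) => N'; rewrite geq_max => /andP[/hN allN kN].
  apply/hasP; exists k; first by rewrite mem_iota.
  apply/hasP; exists v => //; apply/andP; split; last by apply/allP.
  apply/hasP; exists a0 => //; apply/hasP; exists (coef v (false, (b0, (a0, 0%MM)))) => //.
  by apply/mapP; exists b0 => //; rewrite mem_iota ltnS.
have [N hN] := eventually_all step.
by exists N; apply/allP => j /hN; apply.
Qed.

End Correctness.

(** * Decoding the input and assembling the program *)

Lemma rep_seq_lift (U V : Type) (repU : tree -> U -> Prop) (repV : tree -> V -> Prop)
    (g : V -> U) :
  (forall t u, repU t u -> exists2 v, repV t v & u = g v) ->
  forall t s, rep_seq repU t s -> exists2 l, rep_seq repV t l & s = map g l.
Proof.
move=> h; elim=> [|t1 _ t2 IH] [|u s] //=; first by exists [::].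
case=> /h[v tv ->] /IH[l tl ->].
by exists (v :: l).
Qed.

(** [rep_weyl] only asserts that a list of terms exists for each entry. Collecting these lists gives
    data represented by the very same input tree, so the program needs no decoding phase. *)
Lemma rep_system_data (n : nat) (K : fieldType) (repK : Rep K) (r0 r1 : nat)
    (L : 'M[weyl n K]_(r1, r0)) t : rep_system repK t L ->
  exists S : nat * seq (seq (seq (K * ('X_{1..n} * 'X_{1..n})))),
    [/\ rep t S, S.1 = r0, size S.2 = r1 &
        forall (i : 'I_r1) (j : 'I_r0), wsem (entry S i j) = L i j].
Proof.
case: t => // t1 t2 [/= h1 h2].
have [|rows hrows rowsE] := rep_seq_lift (V := seq (seq (K * ('X_{1..n} * 'X_{1..n}))))
  (repV := rep) (g := map (@wsem n K)) _ h2.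
  move=> t s; apply: rep_seq_lift => u p [l ul ->]; exists l => //.
  exact: rep_weyl_sumE.
have szr : size rows = r1.
  have := congr1 size rowsE; rewrite (size_map (fun i => [seq L i j | j <- enum 'I_r0])).
  by rewrite size_enum_ord size_map => ->.
exists (r0, rows); split=> //= i j; have := congr1 (fun s => nth 0 (nth [::] s i) j) rowsE.
rewrite (nth_map i) ?size_enum_ord // (nth_map j) ?size_enum_ord // !nth_ord_enum => ->.
have := congr1 (fun s => size (nth [::] s i)) rowsE.
rewrite (nth_map i) ?size_enum_ord // size_map size_enum_ord.
rewrite (nth_map [::]) ?szr // size_map => szi.
by rewrite (nth_map [::]) // -szi.
Qed.

Theorem mainTheorem4 (R : realType) (K : fieldType)
    (iota : {rmorphism K -> R[i]}) (repK : tree -> K -> Prop)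
    (compK : computable_field repK) (n : nat) :
  exists algo : prog,
    forall (r0 r1 : nat) (L : 'M[weyl n K]_(r1, r0)) (input : tree),
      rep_system repK input L ->
      holonomic (row_submodule L) ->
      exists (output : tree) (B : seq 'cV[{mpoly K[n]}]_r0),
        [/\ runs algo input output,
            rep_vectors repK output B
          & is_basis_mod (@mpolyC n K) (poly_solution L) (eq 0) B].
Proof.
(* Characteristic 0 is inherited from the complex numbers through the embedding. *)
have char0 k : k%:R = 0 :> K -> k = 0%N.
  move=> /(congr1 iota); rewrite rmorph_nat rmorph0 => /eqP.
  by rewrite pnatr_eq0 => /eqP.
pose RK : Rep K := repK.
have [p hp] := tracked_search (tr_bounded (n := n) (compK : computable_field RK)
  (tr_fst tr_id) (tr_snd tr_id)).
have [q hq] := tr_output (n := n) (compK : computable_field RK)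
  (tr_fst tr_id) (tr_snd tr_id).
exists (PComp q p) => r0 r1 L input inputL hol.
have [S [inputS S1 S2 SL]] := rep_system_data inputL.
have [v [N [pv vN bN]]] := hp _ _ inputS (bounded_complete S1 S2 SL char0 hol).
have [t qt tout] := hq _ _ vN.
exists t, [seq fvec r0 N (coef w) | w <- solve S N]; split.
- exact: RComp pv qt.
- exact: (rep_output (repK := RK) S1 S2 SL tout).
apply: (solve_basis S1 S2 SL) => f fL.
exact: (bounded_sound S1 S2 SL bN fL).
Qed.
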